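(* Let $M$ be locally finite in $\mathsf{D}^+(R)$. Let $P$ be locally finite and non-zero in $\mathsf{D}(R^{\mathrm{o}})$ and suppose $\operatorname{amp} P < \infty$. Let $g$ be an integer with $g \geq \operatorname{amp} P$. If the Betti numbers of $M$ have a gap of length $g$ in the sense that there is an integer $j$ such that $$\beta^{\ell}(M) \begin{cases} \neq 0 & \text{for } \ell = j,\\ = 0 & \text{for } j+1 \leq \ell \leq j+g,\\ \neq 0 & \text{for } \ell = j+g+1,\end{cases}$$ then $$\operatorname{amp}(P \otimes^{\mathrm{L}}_R M) \geq g+1.$$
   Context: $k$ is a field and $R$ is a cochain Differential Graded (DG) algebra over $k$ (cohomologically graded) of the form $\cdots \to 0 \to k \to 0 \to R^2 \to R^3 \to \cdots$, i.e. $R^j = 0$ for $j<0$, $R^0 = k$, $R^1 = 0$, with $\dim_k \mathrm{H}^j(R) < \infty$ for each $j$. $\mathsf{D}(R)$ and $\mathsf{D}(R^{\mathrm{o}})$ are the derived categories of DG left-$R$-modules and DG right-$R$-modules, and $\otimes^{\mathrm{L}}_R$ is the left derived tensor product. $\mathsf{D}^+(R)$ is the full subcategory of $\mathsf{D}(R)$ of those $M$ with $\mathrm{H}^j(M) = 0$ for $j \ll 0$. $k$ is viewed as a DG bi-$R$-module concentrated in degree $0$. ''Non-zero'' means not isomorphic to $0$ in the derived category. A DG $R$-module $N$ is locally finite if $\dim_k \mathrm{H}^j(N) < \infty$ for each $j$. For a DG module (or complex) $N$: $\inf N = \inf\{ j \mid \mathrm{H}^j(N) \neq 0\}$, $\sup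 N = \sup\{ j \mid \mathrm{H}^j(N)\neq 0\}$, $\operatorname{amp} N = \sup N - \inf N$, with the conventions $\inf \varnothing = \infty$, $\sup\varnothing = -\infty$. The Betti numbers of a DG left-$R$-module $M$ are $\beta^j(M) = \dim_k \mathrm{H}^j(k \otimes^{\mathrm{L}}_R M)$. *)

(* Defs.v *)
From HB Require Import structures.
From mathcomp Require Import all_boot all_order all_algebra.
From mathcomp Require Import boolp classical_sets constructive_ereal.
(* The notations of monalg clash with those of mathcomp-classical. *)
From mathcomp Require Import -(notations) monalg.
Set Implicit Arguments.
Unset Strict Implicit.
Unset Printing Implicit Defensive.
Import Order.TTheory GRing.Theory Num.Theory.
Local Open Scope ring_scope.

Section Span.
Variables (k : fieldType) (V : lmodType k) (E : V -> Prop).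

Inductive in_span : V -> Prop :=
| in_span0 : in_span 0
| in_spanD a v w : E v -> in_span w -> in_span (a *: v + w).

Definition span_pred : {pred V} := fun v => `[< in_span v >].

Lemma in_span_lin a v w : in_span v -> in_span w -> in_span (a *: v + w).
Proof.
move=> + sw; elim=> [|b x y Ex _ IH]; first by rewrite scaler0 add0r.
by rewrite scalerDr scalerA -addrA; apply: in_spanD.
Qed.

Fact span_closed : submod_closed span_pred.
Proof.
split=> [|a v w /asboolP sv /asboolP sw]; apply/asboolP; first exact: in_span0.
exact: in_span_lin.
Qed.

End Span.

Section Lquot.
Variables (k : fieldType) (V : lmodType k) (S : {pred V}).

Definition submod_pred (S_closed : submod_closed S) : {pred V} := S.
HB.instance Definition _ S_closed :=
  GRing.isSubmodClosed.Build k V (submod_pred S_closed) S_closed.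

Variable S_closed : submod_closed S.
Let S' := submod_pred S_closed.

Definition lquot : Type := Quotient.quot S'.
HB.instance Definition _ := GRing.Zmodule.on lquot.

Definition lpi (v : V) : lquot := (\pi_(Quotient.quot S') v)%qT.
Definition lrepr (q : lquot) : V := (repr (q : Quotient.quot S'))%qT.

Lemma lreprK : cancel lrepr lpi.
Proof. by move=> q; rewrite /lpi /lrepr; apply: reprK. Qed.

Lemma lpiD : {morph lpi : x y / x + y}.
Proof. by move=> x y; exact: (raddfD (\pi_(Quotient.quot S'))%qT). Qed.

Lemma lpiN : {morph lpi : x / - x}.
Proof. by move=> x; exact: (raddfN (\pi_(Quotient.quot S'))%qT). Qed.

Lemma lpi0 : lpi 0 = 0.
Proof. exact: (raddf0 (\pi_(Quotient.quot S'))%qT). Qed.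

Lemma lpi_eq x y : lpi x = lpi y <-> x - y \in S.
Proof.
by rewrite (Quotient.idealrBE S'); split=> [/eqP|/eqP].
Qed.

Lemma lreprE v : lrepr (lpi v) - v \in S.
Proof. by apply/lpi_eq; rewrite lreprK. Qed.

Definition lquot_scale (a : k) (q : lquot) : lquot := lpi (a *: lrepr q).

Lemma lquot_scaleE a v : lquot_scale a (lpi v) = lpi (a *: v).
Proof. by apply/lpi_eq; rewrite -scalerBr (rpredZ (s := S')) // lreprE. Qed.

Fact lquot_scaleA a b q : lquot_scale a (lquot_scale b q) = lquot_scale (a * b) q.
Proof. by rewrite -(lreprK q) !lquot_scaleE scalerA. Qed.
Fact lquot_scale1 : left_id 1 lquot_scale.
Proof. by move=> q; rewrite -(lreprK q) lquot_scaleE scale1r. Qed.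
Fact lquot_scaleDr : right_distributive lquot_scale +%R.
Proof.
move=> a p q; rewrite -(lreprK p) -(lreprK q) -lpiD !lquot_scaleE -lpiD.
by rewrite scalerDr.
Qed.
Fact lquot_scaleDl q : {morph lquot_scale^~ q : a b / a + b}.
Proof.
by move=> a b; rewrite -(lreprK q) !lquot_scaleE -lpiD scalerDl.
Qed.

HB.instance Definition _ := GRing.Zmodule_isLmodule.Build k lquot
  lquot_scaleA lquot_scale1 lquot_scaleDr lquot_scaleDl.

Fact lpi_linear : linear lpi.
Proof. by move=> a x y; rewrite lpiD -lquot_scaleE. Qed.
HB.instance Definition _ := GRing.isLinear.Build k V lquot *:%R lpi lpi_linear.

Lemma lpi_eq0 v : lpi v = 0 <-> v \in S.
Proof. by rewrite -lpi0 lpi_eq subr0. Qed.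

Section Lift.
Variables (U : lmodType k) (f : {linear V -> U}).
Hypothesis fS : forall v, v \in S -> f v = 0.

Lemma lquot_liftE v : f (lrepr (lpi v)) = f v.
Proof. by apply/subr0_eq; rewrite -linearB; apply: fS; apply: lreprE. Qed.

Lemma lquot_lift_linear : linear (f \o lrepr).
Proof.
move=> a p q /=; rewrite -{1}(lreprK p) -{1}(lreprK q) -linearP.
by rewrite lquot_liftE linearP.
Qed.
End Lift.

End Lquot.

Section Dimension.
Variables (k : fieldType) (V : lmodType k).

Definition lin_indep n (v : 'I_n -> V) : Prop :=
  forall c : 'I_n -> k, \sum_i c i *: v i = 0 -> forall i, c i = 0.

(* The dimension in N together with +oo, as an element of \bar int: the       *)
(* supremum of the sizes of the finite linearly independent families.         *)
Definition dimk : \bar int :=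
  supremum -oo%E
    [set (n%:Z)%:E | n in [set n : nat | exists v : 'I_n -> V, lin_indep v]]%classic.

End Dimension.

(* Graded spaces are encoded internally: V is the direct sum of the images of *)
(* the orthogonal idempotents comp i, and comp i v is the component of v in   *)
(* degree i; a cochain complex is such a V with a differential d of degree 1. *)
Record is_complex (k : fieldType) (V : lmodType k)
    (comp : int -> {linear V -> V}) (d : {linear V -> V}) : Prop := IsComplex {
  comp_comp : forall i j x, comp i (comp j x) = if i == j then comp j x else 0;
  comp_sum : forall x, exists2 s : seq int, uniq s & x = \sum_(i <- s) comp i x;
  comp_diff : forall i x, d (comp i x) = comp (i + 1) (d x);
  diff_diff : forall x, d (d x) = 0
}.

Record complex (k : fieldType) := Complex {
  cx_car :> lmodType k;
  comp : int -> {linear cx_car -> cx_car};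
  diff : {linear cx_car -> cx_car};
  complexP : is_complex comp diff
}.
Arguments comp {k c}.
Arguments diff {k c}.

Definition homog (k : fieldType) (X : complex k) (i : int) (x : X) : Prop :=
  comp i x = x.

Section Graded.
Variables (k : fieldType) (X : complex k).

Lemma comp_homog i (x : X) : homog i (comp i x).
Proof. by rewrite /homog (comp_comp (complexP X)) eqxx. Qed.

Lemma comp_homogE i j (x : X) : homog j x -> comp i x = if i == j then x else 0.
Proof. by move=> <-; rewrite (comp_comp (complexP X)). Qed.

Lemma homog_lin i a (x y : X) : homog i x -> homog i y -> homog i (a *: x + y).
Proof. by rewrite /homog linearP => -> ->. Qed.

Lemma homog0 i : homog i (0 : X).
Proof. by rewrite /homog linear0. Qed.

Lemma diff_homog i (x : X) : homog i x -> homog (i + 1) (diff x).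
Proof. by rewrite /homog -(comp_diff (complexP X)) => ->. Qed.

Lemma homog_ind (Q : X -> Prop) :
  Q 0 -> (forall x y, Q x -> Q y -> Q (x + y)) ->
  (forall i x, homog i x -> Q x) -> forall x, Q x.
Proof.
move=> Q0 QD Qh x; have [s _ ->] := comp_sum (complexP X) x.
by apply: big_ind => // i _; apply: (Qh i); apply: comp_homog.
Qed.

Definition supp (x : X) : seq int := projT1 (cid2 (comp_sum (complexP X) x)).

Lemma supp_uniq x : uniq (supp x).
Proof. by rewrite /supp; case: cid2. Qed.

Lemma supp_sum x : x = \sum_(i <- supp x) comp i x.
Proof. by rewrite /supp; case: cid2. Qed.

Lemma comp_supp x i : i \notin supp x -> comp i x = 0.
Proof.
move=> nis; rewrite (supp_sum x) linear_sum big_seq big1 // => j js.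
rewrite (comp_comp (complexP X)); case: eqP => // ij.
by rewrite ij js in nis.
Qed.

Lemma comp_inj (x y : X) : (forall i, comp i x = comp i y) -> x = y.
Proof.
move=> h; apply/eqP; rewrite -subr_eq0; apply/eqP.
rewrite (supp_sum (x - y)) big1 // => i _.
by rewrite linearB h subrr.
Qed.

(* The map x |-> \sum_i g i x_i, where x_i is the component of degree i of x. *)
Definition gsum (U : lmodType k) (g : int -> {linear X -> U}) (x : X) : U :=
  \sum_(i <- supp x) g i (comp i x).

Section GsumTheory.
Variables (U : lmodType k) (g : int -> {linear X -> U}).

Lemma gsumE (s : seq int) x : uniq s -> {subset supp x <= s} ->
  gsum g x = \sum_(i <- s) g i (comp i x).
Proof.
move=> us ss; rewrite (bigID (mem (supp x))) /= [X in _ + X]big1 ?addr0; last first.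
  by move=> i /comp_supp ->; rewrite linear0.
rewrite -big_filter; apply: perm_big; apply: uniq_perm; rewrite ?filter_uniq ?supp_uniq //.
by move=> i; rewrite mem_filter; case: (boolP (i \in supp x)) => // /ss ->.
Qed.

Fact gsum_linear : linear (gsum g).
Proof.
move=> a x y; pose s := undup (supp x ++ supp y ++ supp (a *: x + y)).
have us : uniq s by apply: undup_uniq.
rewrite !(@gsumE s) //; try by move=> i; rewrite mem_undup !mem_cat => ->; rewrite ?orbT.
by rewrite scaler_sumr -big_split /=; apply: eq_bigr => i _; rewrite !linearP.
Qed.
HB.instance Definition _ := GRing.isLinear.Build k X U *:%R (gsum g) gsum_linear.

Lemma gsum_homog i x : homog i x -> gsum g x = g i x.
Proof.
move=> hx; have [xi|xi] := boolP (i \in supp x); last first.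
  have x0 : x = 0 by rewrite -hx comp_supp.
  by rewrite x0 !linear0.
rewrite /gsum (bigD1_seq i) ?supp_uniq //= hx big1 ?addr0 // => j ji.
by rewrite (comp_homogE j hx) (negPf ji) linear0.
Qed.

End GsumTheory.

End Graded.

Definition sgn (k : fieldType) (i : int) : k := (-1) ^ i.

Lemma sgnD (k : fieldType) i j : sgn k (i + j) = sgn k i * sgn k j.
Proof. by rewrite /sgn expfzDr // oppr_eq0 oner_eq0. Qed.

Lemma sgnS (k : fieldType) i : sgn k (i + 1) = - sgn k i.
Proof. by rewrite sgnD [sgn k 1]expr1z mulrN1. Qed.

Section Cohomology.
Variables (k : fieldType) (X : complex k) (j : int).

Definition cocycle_pred : {pred X} := fun x => (comp j x == x) && (diff x == 0).

Fact cocycle_closed : submod_closed cocycle_pred.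
Proof.
split=> [|a x y /andP[/eqP hx /eqP dx] /andP[/eqP hy /eqP dy]].
  by rewrite unfold_in !linear0 !eqxx.
by rewrite unfold_in !linearP /= hx hy dx dy scaler0 addr0 !eqxx.
Qed.
HB.instance Definition _ :=
  GRing.isSubmodClosed.Build k X cocycle_pred cocycle_closed.

Record cocycle := Cocycle { cocycle_val :> X; _ : cocycle_val \in cocycle_pred }.
HB.instance Definition _ := [isSub for cocycle_val].
HB.instance Definition _ := [Choice of cocycle by <:].
HB.instance Definition _ := [SubChoice_isSubLmodule of cocycle by <:].

Definition boundary_pred : {pred cocycle} :=
  fun z => `[< exists2 y : X, homog (j - 1) y & val z = diff y >].

Fact boundary_closed : submod_closed boundary_pred.
Proof.
split=> [|a x y /asboolP[u hu xu] /asboolP[v hv yv]]; apply/asboolP.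
  by exists 0; [exact: homog0 | rewrite !linear0].
by exists (a *: u + v); [exact: homog_lin | rewrite !linearP /= xu yv].
Qed.

Definition cohomology : lmodType k := lquot boundary_closed.

End Cohomology.

Notation "''H^' j ( X )" := (cohomology X j)
  (at level 8, j at level 2, format "''H^' j ( X )").

Definition trivial_space (k : fieldType) (V : lmodType k) : Prop :=
  forall v : V, v = 0.

Definition locally_finite (k : fieldType) (X : complex k) : Prop :=
  forall j, (dimk 'H^j(X) < +oo)%E.

Definition acyclic (k : fieldType) (X : complex k) : Prop :=
  forall j, trivial_space 'H^j(X).

(* X is isomorphic to 0 in the derived category iff it is acyclic. *)
Definition nonzero_in_D (k : fieldType) (X : complex k) : Prop := ~ acyclic X.

Definition bounded_below (k : fieldType) (X : complex k) : Prop :=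
  exists n : int, forall j, j < n -> trivial_space 'H^j(X).

Definition hsupport (k : fieldType) (X : complex k) : set int :=
  [set j | ~ trivial_space 'H^j(X)]%classic.

Definition hsup (k : fieldType) (X : complex k) : \bar int :=
  supremum -oo%E [set j%:E | j in hsupport X]%classic.

Definition hinf (k : fieldType) (X : complex k) : \bar int :=
  infimum +oo%E [set j%:E | j in hsupport X]%classic.

Definition amp (k : fieldType) (X : complex k) : \bar int := (hsup X - hinf X)%E.

Record chain_map (k : fieldType) (X Y : complex k) := ChainMap {
  cm_fun :> {linear X -> Y};
  cm_comp : forall i x, cm_fun (comp i x) = comp i (cm_fun x);
  cm_diff : forall x, cm_fun (diff x) = diff (cm_fun x)
}.

Section Hmap.
Variables (k : fieldType) (X Y : complex k) (f : chain_map X Y) (j : int).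

Fact chain_map_cocycle (z : cocycle X j) : f (val z) \in @cocycle_pred k Y j.
Proof.
case: z => x /= /andP[/eqP hx /eqP dx].
by rewrite unfold_in -cm_comp -cm_diff hx dx linear0 !eqxx.
Qed.

Definition cocycle_map (z : cocycle X j) : cocycle Y j :=
  Cocycle (chain_map_cocycle z).

Definition Hmap (h : 'H^j(X)) : 'H^j(Y) :=
  lpi (@boundary_closed k Y j) (cocycle_map (lrepr h)).

(* Hmap does not depend on the representative. *)
Lemma HmapE z :
  Hmap (lpi (@boundary_closed k X j) z) = lpi (@boundary_closed k Y j) (cocycle_map z).
Proof.
apply/lpi_eq; have /asboolP[y hy Ey] := lreprE (@boundary_closed k X j) z.
apply/asboolP; exists (f y); first by rewrite /homog -cm_comp hy.
by rewrite raddfB /= -cm_diff -Ey !raddfB.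
Qed.

End Hmap.

Definition quasi_iso (k : fieldType) (X Y : complex k) (f : chain_map X Y) : Prop :=
  forall j, bijective (@Hmap k X Y f j).

Record dga (k : fieldType) := DGA {
  dga_alg :> algType k;
  dga_comp : int -> {linear dga_alg -> dga_alg};
  dga_diff : {linear dga_alg -> dga_alg};
  dga_complexP : is_complex dga_comp dga_diff;
  dga_comp1 : dga_comp 0 1 = 1;
  dga_homogM : forall i j r s, dga_comp i r = r -> dga_comp j s = s ->
    dga_comp (i + j) (r * s) = r * s;
  dga_leibniz : forall i r s, dga_comp i r = r ->
    dga_diff (r * s) = dga_diff r * s + sgn k i *: (r * dga_diff s)
}.

Arguments dga_comp {k d}.
Arguments dga_diff {k d}.

Definition dga_cx (k : fieldType) (R : dga k) : complex k :=
  Complex (dga_complexP R).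

Record dglmod (k : fieldType) (R : dga k) := DGLMod {
  dgl_cx :> complex k;
  lact : R -> dgl_cx -> dgl_cx;
  lact_linl : forall x, linear (lact^~ x);
  lact_linr : forall r, linear (lact r);
  lact1 : forall x, lact 1 x = x;
  lactM : forall r s x, lact (r * s) x = lact r (lact s x);
  lact_homog : forall i j (r : dga_cx R) x,
    homog i r -> homog j x -> homog (i + j) (lact r x);
  lact_leibniz : forall i (r : dga_cx R) x, homog i r ->
    diff (lact r x) = lact (diff r) x + sgn k i *: lact r (diff x)
}.

Record dgrmod (k : fieldType) (R : dga k) := DGRMod {
  dgr_cx :> complex k;
  ract : dgr_cx -> R -> dgr_cx;
  ract_linl : forall r, linear (ract^~ r);
  ract_linr : forall x, linear (ract x);
  ract1 : forall x, ract x 1 = x;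
  ractM : forall x r s, ract x (r * s) = ract (ract x r) s;
  ract_homog : forall i j x (r : dga_cx R),
    homog i x -> homog j r -> homog (i + j) (ract x r);
  ract_leibniz : forall i x (r : dga_cx R), homog i x ->
    diff (ract x r) = ract (diff x) r + sgn k i *: ract x (diff r)
}.

Record dgl_map (k : fieldType) (R : dga k) (M N : dglmod R) := DGLMap {
  dglm_map :> chain_map M N;
  dglm_lact : forall r x, dglm_map (lact r x) = lact r (dglm_map x)
}.

Definition null_homotopic (k : fieldType) (R : dga k) (M N : dglmod R)
    (f : dgl_map M N) : Prop :=
  exists h : {linear M -> N},
    [/\ forall i x, homog i x -> homog (i - 1) (h x),
        forall i (r : dga_cx R) x, homog i r ->
          h (lact r x) = sgn k i *: lact r (h x)
      & forall x, f x = diff (h x) + h (diff x)].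

(* Hom_R(F, A) is acyclic for A acyclic: since the shifts of A are acyclic    *)
(* too, it suffices to consider cochain maps of degree 0.                     *)
Definition K_projective (k : fieldType) (R : dga k) (F : dglmod R) : Prop :=
  forall (A : dglmod R) (f : dgl_map F A), acyclic A -> null_homotopic f.

Record Kproj_resolution (k : fieldType) (R : dga k) (M : dglmod R) :=
  KprojResolution {
    res_mod :> dglmod R;
    res_map : dgl_map res_mod M;
    res_Kproj : K_projective res_mod;
    res_qis : quasi_iso res_map
  }.

Section Tensor.
Variables (k : fieldType) (R : dga k) (P : dgrmod R) (F : dglmod R).

Let free : lmodType k := malg (P * F)%type k.
Let gen (p : P) (x : F) : free := mkmalgU (p, x) 1.

Inductive tensor_rel : free -> Prop :=
| tensor_rel_linl a p q x : tensor_rel (gen (a *: p + q) x - (a *: gen p x + gen q x))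
| tensor_rel_linr p a x y : tensor_rel (gen p (a *: x + y) - (a *: gen p x + gen p y))
| tensor_rel_bal p r x : tensor_rel (gen (ract p r) x - gen p (lact r x)).

Definition tensor_space : lmodType k := lquot (span_closed tensor_rel).

Definition tens (p : P) (x : F) : tensor_space := lpi (span_closed tensor_rel) (gen p x).

Lemma tensor_rel0 v : tensor_rel v -> lpi (span_closed tensor_rel) v = 0.
Proof.
move=> rv; apply/lpi_eq0/asboolP; rewrite -[v]addr0 -[v]scale1r.
by apply: in_spanD => //; apply: in_span0.
Qed.

Lemma tens_linl x : linear (tens^~ x).
Proof.
move=> a p q; apply/eqP; rewrite -subr_eq0 /tens -linearP -raddfB; apply/eqP.
exact/tensor_rel0/tensor_rel_linl.
Qed.

Lemma tens_linr p : linear (tens p).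
Proof.
move=> a x y; apply/eqP; rewrite -subr_eq0 /tens -linearP -raddfB; apply/eqP.
exact/tensor_rel0/tensor_rel_linr.
Qed.

Lemma tens_bal p r x : tens (ract p r) x = tens p (lact r x).
Proof.
apply/eqP; rewrite -subr_eq0 /tens -raddfB; apply/eqP.
exact/tensor_rel0/tensor_rel_bal.
Qed.

HB.instance Definition _ p := GRing.isLinear.Build k F tensor_space *:%R (tens p)
  (tens_linr p).

Definition tensl (x : F) (p : P) : tensor_space := tens p x.
HB.instance Definition _ x := GRing.isLinear.Build k P tensor_space *:%R (tensl x)
  (tens_linl x).

Lemma tensZl a p x : tens (a *: p) x = a *: tens p x.
Proof. exact: (linearZ_LR (tensl x)). Qed.

Lemma tensDl p q x : tens (p + q) x = tens p x + tens q x.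
Proof. exact: (linearD (tensl x)). Qed.

Lemma tens0l x : tens 0 x = 0.
Proof. exact: (linear0 (tensl x)). Qed.

Lemma tens_ind (Q : tensor_space -> Prop) :
  Q 0 -> (forall u v, Q u -> Q v -> Q (u + v)) -> (forall p x, Q (tens p x)) ->
  forall u, Q u.
Proof.
move=> Q0 QD Qt u; rewrite -(lreprK u); move: (lrepr u) => g.
rewrite (monalgE g) linear_sum; apply: big_ind => // -[p x] _.
have -> : mkmalgU (p, x) (mcoeff (p, x) g) = mcoeff (p, x) g *: gen p x :> free.
  by apply/malgP => y; rewrite mcoeffZ !mcoeffU mulrnAr mulr1.
rewrite linearZ_LR [X in Q X](_ : _ = tens (mcoeff (p, x) g *: p) x) //.
by rewrite tensZl.
Qed.

Section Lift.
Variables (U : lmodType k) (f : P -> F -> U).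
Hypotheses (f_linl : forall x, linear (f^~ x)) (f_linr : forall p, linear (f p)).
Hypothesis f_bal : forall p r x, f (ract p r) x = f p (lact r x).

Let flift (g : free) : U :=
  \sum_(y <- finmap.enum_fset (msupp g)) mcoeff y g *: f y.1 y.2.

Let fliftE (s : seq (P * F)) g : uniq s -> {subset finmap.enum_fset (msupp g) <= s} ->
  flift g = \sum_(y <- s) mcoeff y g *: f y.1 y.2.
Proof.
move=> us ss; rewrite (bigID (mem (finmap.enum_fset (msupp g)))) /=.
rewrite [X in _ + X]big1 ?addr0; last first.
  by move=> y yg; rewrite mcoeff_outdom ?scale0r.
rewrite -big_filter; apply: perm_big; apply: uniq_perm.
- exact: finmap.fset_uniq.
- exact: filter_uniq.
by move=> i; rewrite mem_filter; case: (boolP (i \in finmap.enum_fset _)) => // /ss ->.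
Qed.

Let flift_linear : linear flift.
Proof.
move=> a g h; pose s := undup (finmap.enum_fset (msupp g) ++
  finmap.enum_fset (msupp h) ++ finmap.enum_fset (msupp (a *: g + h))).
have us : uniq s by apply: undup_uniq.
rewrite !(@fliftE s) //; try by move=> i; rewrite mem_undup !mem_cat => ->; rewrite ?orbT.
rewrite scaler_sumr -big_split /=; apply: eq_bigr => i _.
by rewrite mcoeffD mcoeffZ scalerDl scalerA.
Qed.
HB.instance Definition _ := GRing.isLinear.Build k free U *:%R flift flift_linear.

Let flift_gen p x : flift (gen p x) = f p x.
Proof.
rewrite (@fliftE [:: (p, x)]) //; last first.
  by move=> y; rewrite msuppU oner_eq0 mem_seq1 -finmap.in_fset1.
by rewrite big_seq1 mcoeffU eqxx scale1r.
Qed.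

Let flift_rel v : v \in span_pred tensor_rel -> flift v = 0.
Proof.
move/asboolP; elim=> [|a w u rw _ IH]; first exact: linear0.
rewrite flift_linear IH addr0; suff -> : flift w = 0 by rewrite scaler0.
have fliftB x y : flift (x - y) = flift x - flift y by exact: linearB.
by case: rw => *; rewrite fliftB ?flift_linear !flift_gen ?f_linl ?f_linr ?f_bal subrr.
Qed.

Definition tens_lift (u : tensor_space) : U := flift (lrepr u).

Fact tens_lift_linear : linear tens_lift.
Proof. exact: lquot_lift_linear flift_rel. Qed.

Lemma tens_liftE p x : tens_lift (tens p x) = f p x.
Proof. exact: etrans (lquot_liftE _ flift_rel _) (flift_gen p x). Qed.

End Lift.


Lemma tens_homog_ind (Q : tensor_space -> Prop) :
  Q 0 -> (forall u v, Q u -> Q v -> Q (u + v)) ->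
  (forall i j p x, homog i p -> homog j x -> Q (tens p x)) -> forall u, Q u.
Proof.
move=> Q0 QD Qh; apply: tens_ind => // p x.
elim/homog_ind: p => [|p q|i p hp]; first by rewrite tens0l.
  by rewrite tensDl; apply: QD.
elim/homog_ind: x => [|x y|j x hx]; first by rewrite linear0.
  by rewrite linearD; apply: QD.
exact: Qh hp hx.
Qed.

Lemma lactDl r s (x : F) : lact (r + s) x = lact r x + lact s x.
Proof. by have := lact_linl x 1 r s; rewrite !scale1r. Qed.
Lemma lactDr r (x y : F) : lact r (x + y) = lact r x + lact r y.
Proof. by have := lact_linr r 1 x y; rewrite !scale1r. Qed.
Lemma lact0l (x : F) : lact 0 x = 0.
Proof. by apply: (addrI (lact 0 x)); rewrite -lactDl !addr0. Qed.
Lemma lact0r r : lact r (0 : F) = 0.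
Proof. by apply: (addrI (lact r 0)); rewrite -lactDr !addr0. Qed.
Lemma lactZr r a (x : F) : lact r (a *: x) = a *: lact r x.
Proof. by have := lact_linr r a x 0; rewrite lact0r !addr0. Qed.
Lemma ractDl (p q : P) r : ract (p + q) r = ract p r + ract q r.
Proof. by have := ract_linl r 1 p q; rewrite !scale1r. Qed.
Lemma ractDr (p : P) r s : ract p (r + s) = ract p r + ract p s.
Proof. by have := ract_linr p 1 r s; rewrite !scale1r. Qed.
Lemma ract0l r : ract (0 : P) r = 0.
Proof. by apply: (addrI (ract 0 r)); rewrite -ractDl !addr0. Qed.
Lemma ract0r (p : P) : ract p 0 = 0.
Proof. by apply: (addrI (ract p 0)); rewrite -ractDr !addr0. Qed.

Lemma lact_comp l n (r : dga_cx R) (x : F) : homog l r ->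
  comp n (lact r x) = lact r (comp (n - l) x).
Proof.
move=> hr; elim/homog_ind: x => [|x y IHx IHy|j x hx].
- by rewrite lact0r !linear0 lact0r.
- by rewrite lactDr !linearD lactDr IHx IHy.
rewrite (comp_homogE _ (lact_homog hr hx)) (comp_homogE _ hx).
by rewrite subr_eq [l + j]addrC; case: eqP; rewrite ?lact0r.
Qed.

(* A bilinear map is R-balanced as soon as it is so on homogeneous p and r. *)
Lemma bal_homog (U : lmodType k) (f : P -> F -> U) :
  (forall x, linear (f^~ x)) -> (forall p, linear (f p)) ->
  (forall i l p (r : dga_cx R) x, homog i p -> homog l r ->
     f (ract p r) x = f p (lact r x)) ->
  forall p r x, f (ract p r) x = f p (lact r x).
Proof.
move=> fl fr fh p r x.
have flD y q q' : f (q + q') y = f q y + f q' y.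
  by have := fl y 1 q q'; rewrite !scale1r.
have frD q y y' : f q (y + y') = f q y + f q y'.
  by have := fr q 1 y y'; rewrite !scale1r.
have fl0 y : f 0 y = 0 by apply: (addrI (f 0 y)); rewrite -flD !addr0.
have fr0 q : f q 0 = 0 by apply: (addrI (f q 0)); rewrite -frD !addr0.
elim/homog_ind: p => [|p q IHp IHq|i p hp].
- by rewrite ract0l !fl0.
- by rewrite ractDl !flD IHp IHq.
elim/(@homog_ind k (dga_cx R)): r => [|r s IHr IHs|l r hr].
- by rewrite ract0r lact0l fl0 fr0.
- by rewrite ractDr lactDl flD frD IHr IHs.
exact: fh hp hr.
Qed.

Definition tcomp_fun (n : int) (p : P) (x : F) : tensor_space :=
  gsum (fun i => tensl (comp (n - i) x)) p.

Fact tcomp_linl n x : linear (tcomp_fun n ^~ x).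
Proof. exact: gsum_linear. Qed.

Fact tcomp_linr n p : linear (tcomp_fun n p).
Proof.
move=> a x y; rewrite /tcomp_fun /gsum scaler_sumr -big_split /=.
by apply: eq_bigr => i _; rewrite /tensl !linearP.
Qed.

Lemma tcomp_homogl n i p x : homog i p -> tcomp_fun n p x = tens p (comp (n - i) x).
Proof. by move=> hp; rewrite /tcomp_fun (gsum_homog _ hp). Qed.

Fact tcomp_bal n p r x : tcomp_fun n (ract p r) x = tcomp_fun n p (lact r x).
Proof.
move: p r x; apply: bal_homog; [exact: tcomp_linl | exact: tcomp_linr |].
move=> i l p r x hp hr; rewrite (tcomp_homogl _ _ hp).
rewrite (tcomp_homogl _ _ (ract_homog hp hr)) tens_bal (lact_comp _ _ hr).
by rewrite opprD addrA.
Qed.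

Definition tensor_comp (n : int) : tensor_space -> tensor_space :=
  tens_lift (tcomp_fun n).

HB.instance Definition _ n :=
  GRing.isLinear.Build k tensor_space tensor_space *:%R (tensor_comp n)
    (tens_lift_linear (@tcomp_linl n) (@tcomp_linr n) (@tcomp_bal n)).

Definition sgn_op (p : P) : P := gsum (fun i => GRing.scale (sgn k i)) p.

Lemma sgn_op_homog i p : homog i p -> sgn_op p = sgn k i *: p.
Proof. by move=> hp; rewrite /sgn_op (gsum_homog _ hp). Qed.

HB.instance Definition _ := GRing.isLinear.Build k P P *:%R sgn_op (gsum_linear _).

(* d (p (x) x) = d p (x) x + (-1)^|p| p (x) d x *)
Definition tdiff_fun (p : P) (x : F) : tensor_space :=
  tens (diff p) x + tens (sgn_op p) (diff x).

Fact tdiff_linl x : linear (tdiff_fun^~ x).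
Proof.
move=> a p q; rewrite /tdiff_fun !linearP !tensDl !tensZl scalerDr.
by rewrite addrACA.
Qed.

Fact tdiff_linr p : linear (tdiff_fun p).
Proof. by move=> a x y; rewrite /tdiff_fun !linearP scalerDr addrACA. Qed.

Lemma tdiff_homogl i p x : homog i p ->
  tdiff_fun p x = tens (diff p) x + sgn k i *: tens p (diff x).
Proof. by move=> hp; rewrite /tdiff_fun (sgn_op_homog hp) tensZl. Qed.

Fact tdiff_bal p r x : tdiff_fun (ract p r) x = tdiff_fun p (lact r x).
Proof.
move: p r x; apply: bal_homog; [exact: tdiff_linl | exact: tdiff_linr |].
move=> i l p r x hp hr; rewrite (tdiff_homogl _ hp).
rewrite (tdiff_homogl _ (ract_homog hp hr)) (ract_leibniz _ hp) (lact_leibniz _ hr).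
rewrite tensDl tensZl !tens_bal linearD linearZ_LR scalerDr scalerA -sgnD.
by rewrite addrA.
Qed.

Definition tensor_diff : tensor_space -> tensor_space := tens_lift tdiff_fun.

HB.instance Definition _ :=
  GRing.isLinear.Build k tensor_space tensor_space *:%R tensor_diff
    (tens_lift_linear tdiff_linl tdiff_linr tdiff_bal).

Lemma tensor_comp_homog n i j p x : homog i p -> homog j x ->
  tensor_comp n (tens p x) = if n == i + j then tens p x else 0.
Proof.
move=> hp hx; rewrite /tensor_comp tens_liftE; last 3 first.
- exact: tcomp_linl.
- exact: tcomp_linr.
- exact: tcomp_bal.
rewrite (tcomp_homogl _ _ hp) (comp_homogE _ hx) subr_eq addrC.
by case: eqP => // _; rewrite linear0.
Qed.

Lemma tensor_diff_homog i p x : homog i p ->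
  tensor_diff (tens p x) = tens (diff p) x + sgn k i *: tens p (diff x).
Proof.
move=> hp; rewrite /tensor_diff tens_liftE; first exact: tdiff_homogl.
- exact: tdiff_linl.
- exact: tdiff_linr.
- exact: tdiff_bal.
Qed.

Let tc0 n : tensor_comp n 0 = 0. Proof. exact: linear0. Qed.
Let tcD n u v : tensor_comp n (u + v) = tensor_comp n u + tensor_comp n v.
Proof. exact: linearD. Qed.
Let tcZ n a u : tensor_comp n (a *: u) = a *: tensor_comp n u.
Proof. exact: linearZ_LR. Qed.
Let td0 : tensor_diff 0 = 0. Proof. exact: linear0. Qed.
Let tdD u v : tensor_diff (u + v) = tensor_diff u + tensor_diff v.
Proof. exact: linearD. Qed.
Let tdZ a u : tensor_diff (a *: u) = a *: tensor_diff u.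
Proof. exact: linearZ_LR. Qed.

Fact tensor_comp_comp m n u :
  tensor_comp m (tensor_comp n u) = if m == n then tensor_comp n u else 0.
Proof.
elim/tens_homog_ind: u => [|u v IHu IHv|i j p x hp hx].
- by rewrite !tc0 if_same.
- by rewrite !tcD IHu IHv; case: eqP; rewrite ?addr0.
rewrite !(tensor_comp_homog _ hp hx); case: (n =P i + j) => [->|_].
  by rewrite (tensor_comp_homog _ hp hx).
by rewrite tc0 if_same.
Qed.

Fact tensor_comp_sum u :
  exists2 s : seq int, uniq s & u = \sum_(i <- s) tensor_comp i u.
Proof.
suff [s hs] : exists s : seq int, forall s', uniq s' ->
    {subset s <= s'} -> u = \sum_(i <- s') tensor_comp i u.
  exists (undup s); first exact: undup_uniq.
  by apply: hs; [exact: undup_uniq | move=> i; rewrite mem_undup].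
elim/tens_homog_ind: u => [|u v [s hs] [t ht]|i j p x hp hx].
- by exists [::] => s' _ _; rewrite big1 // => i _; rewrite tc0.
- exists (s ++ t) => s' us' ss'; under eq_bigr do rewrite tcD.
  rewrite big_split /=; congr (_ + _).
    by apply: hs => // i is_; apply: ss'; rewrite mem_cat is_.
  by apply: ht => // i it; apply: ss'; rewrite mem_cat it orbT.
exists [:: i + j] => s' us' ss'.
rewrite (bigD1_seq (i + j)) ?ss' ?mem_head //= (tensor_comp_homog _ hp hx) eqxx.
rewrite big1 => [|n nij]; first by rewrite addr0.
by rewrite (tensor_comp_homog _ hp hx) (negPf nij).
Qed.

Fact tensor_comp_diff n u :
  tensor_diff (tensor_comp n u) = tensor_comp (n + 1) (tensor_diff u).
Proof.
elim/tens_homog_ind: u => [|u v IHu IHv|i j p x hp hx].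
- by rewrite !(tc0, td0).
- by rewrite !(tcD, tdD) IHu IHv.
rewrite (tensor_comp_homog _ hp hx) (tensor_diff_homog _ hp) tcD tcZ.
rewrite (tensor_comp_homog _ (diff_homog hp) hx).
rewrite (tensor_comp_homog _ hp (diff_homog hx)) addrA [i + 1 + j]addrAC.
rewrite !(inj_eq (addIr _)); case: eqP => _; last by rewrite scaler0 addr0 td0.
exact: tensor_diff_homog.
Qed.

Fact tensor_diff_diff u : tensor_diff (tensor_diff u) = 0.
Proof.
elim/tens_homog_ind: u => [|u v IHu IHv|i j p x hp hx].
- by rewrite !td0.
- by rewrite !tdD IHu IHv addr0.
rewrite (tensor_diff_homog _ hp) tdD tdZ (tensor_diff_homog _ hp).
rewrite (tensor_diff_homog _ (diff_homog hp)).
rewrite !(diff_diff (complexP _)) tens0l linear0 add0r scaler0 addr0.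
by rewrite sgnS scaleNr addNr.
Qed.

Definition tensor_is_complex : is_complex tensor_comp tensor_diff :=
  IsComplex tensor_comp_comp tensor_comp_sum tensor_comp_diff tensor_diff_diff.

Definition tensor : complex k := Complex tensor_is_complex.

End Tensor.

(* M enters a derived tensor product through a K-projective resolution F; up  *)
(* to quasi-isomorphism the result does not depend on the choice of F.        *)
Definition Ltensor (k : fieldType) (R : dga k) (P : dgrmod R) (M : dglmod R)
    (F : Kproj_resolution M) : complex k := tensor P F.

(* R^j = 0 for j < 0 and R^0 = k; as R is a nonzero k-algebra, the map        *)
(* a |-> a%:A is then an isomorphism from k onto R^0.                         *)
Record connected (k : fieldType) (R : dga k) : Prop := Connected {
  conn_neg : forall j (r : dga_cx R), j < 0 -> homog j r -> r = 0;
  conn_zero : forall r : dga_cx R, homog 0 r -> exists a : k, r = a%:A :> R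
}.

Section ResidueField.
Variables (k : fieldType) (R : dga k) (R_conn : connected R).

(* The augmentation R -> R^0 = k. *)
Definition aug (r : R) : k := xget 0 [set a : k | dga_comp 0 r = a%:A]%classic.

Lemma augE r : dga_comp 0 r = (aug r)%:A.
Proof.
rewrite /aug; have [a ra] := conn_zero R_conn (@comp_homog _ (dga_cx R) 0 r).
by case: xgetP => [b _ ->|/(_ a)].
Qed.

Lemma scal_inj (a b : k) : a%:A = b%:A :> R -> a = b.
Proof.
move/eqP; rewrite -subr_eq0 -scalerBl => /eqP ab; apply/eqP; rewrite -subr_eq0.
apply: contraT => nz; have := oner_neq0 R.
by rewrite -[1]scale1r -(mulVf nz) -scalerA ab scaler0 eqxx.
Qed.

Lemma aug_linear a r s : aug (a *: r + s) = a * aug r + aug s.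
Proof.
by apply: scal_inj; rewrite -augE linearP !augE scalerDl scalerA.
Qed.

Lemma augD r s : aug (r + s) = aug r + aug s.
Proof. by rewrite -[r]scale1r aug_linear mul1r scale1r. Qed.

Lemma aug0 : aug 0 = 0.
Proof. by apply: (addrI (aug 0)); rewrite -augD !addr0. Qed.

Lemma aug1 : aug 1 = 1.
Proof. by apply: scal_inj; rewrite -augE dga_comp1 scale1r. Qed.

Lemma aug_homog i (r : dga_cx R) : homog i r -> i != 0 -> aug r = 0.
Proof.
move=> hr i0; apply: scal_inj; rewrite -augE scale0r.
by have := comp_homogE 0 hr; rewrite eq_sym (negPf i0).
Qed.

Lemma augM r s : aug (r * s) = aug r * aug s.
Proof.
elim/(@homog_ind k (dga_cx R)): r => [|r r' IHr IHr'|i r hr].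
- by rewrite mul0r aug0 mul0r.
- by rewrite mulrDl !augD mulrDl IHr IHr'.
elim/(@homog_ind k (dga_cx R)): s => [|s s' IHs IHs'|j s hs].
- by rewrite mulr0 aug0 mulr0.
- by rewrite mulrDr !augD mulrDr IHs IHs'.
have [i0|i0|i0] := ltgtP i 0.
- by rewrite (conn_neg R_conn i0 hr) mul0r aug0 mul0r.
- have [j0|j0] := ltP j 0.
    by rewrite (conn_neg R_conn j0 hs) mulr0 aug0 mulr0.
  rewrite (aug_homog hr) ?gt_eqF // mul0r.
  by apply: (aug_homog (dga_homogM hr hs)); rewrite gt_eqF // ltr_wpDr.
rewrite i0 in hr; apply: scal_inj; rewrite -augE.
have Er : r = (aug r)%:A :> R by rewrite -augE hr.
have -> : dga_comp 0 (r * s : R) = aug r *: dga_comp 0 s.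
  by rewrite [in LHS]Er -scalerAl mul1r linearZ_LR.
by rewrite augE scalerA.
Qed.

Lemma aug_diff r : aug (dga_diff r) = 0.
Proof.
apply: scal_inj; rewrite -augE scale0r.
have := comp_diff (dga_complexP R) (-1) r; rewrite addNr => <-.
have -> : dga_comp (-1) r = 0; last by rewrite linear0.
exact: (conn_neg R_conn _ (@comp_homog _ (dga_cx R) (-1) r)).
Qed.

Definition k_comp (i : int) (x : k^o) : k^o := if i == 0 then x else 0.
Definition k_diff (x : k^o) : k^o := 0.

Fact k_comp_linear i : linear (k_comp i).
Proof. by move=> a x y; rewrite /k_comp; case: eqP; rewrite ?scaler0 ?addr0. Qed.
HB.instance Definition _ i :=
  GRing.isLinear.Build k k^o k^o *:%R (k_comp i) (k_comp_linear i).

Fact k_diff_linear : linear k_diff.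
Proof. by move=> a x y; rewrite /k_diff scaler0 addr0. Qed.
HB.instance Definition _ :=
  GRing.isLinear.Build k k^o k^o *:%R k_diff k_diff_linear.

Fact k_is_complex : is_complex k_comp k_diff.
Proof.
split=> //= [i j x|x|i x].
- rewrite /k_comp; case: (i =P j) => [->|ij]; first by case: (j =P 0).
  case: (i =P 0) => // i0; case: (j =P 0) => // j0.
  by case: ij; rewrite i0 j0.
- by exists [:: 0] => //; rewrite big_seq1.
- by rewrite /k_comp /k_diff if_same.
Qed.

Definition k_cx : complex k := Complex k_is_complex.

Definition k_ract (x : k_cx) (r : R) : k_cx := (x : k) * aug r.

Fact k_ract_linl r : linear (k_ract^~ r).
Proof. by move=> a x y; rewrite /k_ract mulrDl -mulrA. Qed.
Fact k_ract_linr x : linear (k_ract x).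
Proof. by move=> a r s; rewrite /k_ract aug_linear mulrDr mulrCA. Qed.
Fact k_ract1 x : k_ract x 1 = x.
Proof. by rewrite /k_ract aug1 mulr1. Qed.
Fact k_ractM x r s : k_ract x (r * s) = k_ract (k_ract x r) s.
Proof. by rewrite /k_ract augM mulrA. Qed.
Fact k_ract_homog i j x (r : dga_cx R) :
  homog i x -> homog j r -> homog (i + j) (k_ract x r).
Proof.
rewrite /k_ract /homog /= /k_comp => hx hr.
have [j0|j0] := eqVneq j 0; last by rewrite (aug_homog hr j0) mulr0 if_same.
by rewrite j0 addr0; case: eqP hx => // _ <-; rewrite mul0r.
Qed.
Fact k_ract_leibniz i x (r : dga_cx R) : homog i x ->
  diff (k_ract x r) = k_ract (diff x) r + sgn k i *: k_ract x (diff r).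
Proof.
by rewrite /k_ract /= /k_diff mul0r aug_diff mulr0 scaler0 addr0.
Qed.

(* k as a DG right R-module, concentrated in degree 0. *)
Definition kmod : dgrmod R := DGRMod k_ract_linl k_ract_linr k_ract1 k_ractM
  k_ract_homog k_ract_leibniz.

Definition betti (M : dglmod R) (F : Kproj_resolution M) (j : int) : \bar int :=
  dimk 'H^j(Ltensor kmod F).

End ResidueField.

(* Main.v *)
Require Import Defs.
From HB Require Import structures.
From mathcomp Require Import all_boot all_order all_algebra.
From mathcomp Require Import boolp classical_sets functions constructive_ereal.
From mathcomp Require Import zify.
Set Implicit Arguments.
Unset Strict Implicit.
Unset Printing Implicit Defensive.
(* This makes comp the component of a graded space again, rather than the
   composition of functions. *)
Import Defs.
Import Order.TTheory GRing.Theory Num.Theory.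
Local Open Scope ring_scope.

(** Let i and s be the lowest and the highest degree of the cohomology of P, so
    that s - i <= g, and let F be a K-projective left module. Both the tensor
    product with P and the Betti numbers are governed by maps out of F.

    A functional of degree -n on the tensor product of P and F is a map from F to
    the left module Q = Hom_k(P, k), placed so that P^i has degree n - i. If the
    tensor product has no cohomology in degree n, every such map is null homotopic
    (dual_null). The cohomology of Q lives in the degrees from n - s to n - i, and
    it is nonzero in degree n - i (dual_Hvanish, dual_nonvanish). With k in place
    of P, the l-th Betti number of F vanishes if and only if all maps from F to
    vector spaces in degree l, on which R acts through its augmentation, are null
    homotopic (null_of_betti, nonnull_of_betti).

    The heart of the proof (nonnull_exists) is that a Betti number of F in degree
    N, preceded by a gap of length at least s - i, yields a map from F to Q which
    is not null homotopic, for n = i + N, that is, when N is the top degree of the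
    cohomology of Q. As R^0 = k and R^j = 0 for j < 0, a module has truncations
    that are submodules (truncation). As R^1 = 0, a module with cohomology in two
    adjacent degrees is quasi-isomorphic to this cohomology (two_degree_formal);
    hence the N-th Betti number gives a map from F to the truncation of Q to the
    degrees N - 1 and N. It remains nonzero in Q, since each further cohomology
    group of Q could only kill it through a Betti number that vanishes.

    This applies to N = j + g + 1, at the upper end of the gap. It also applies to
    the least degree N = m of a nonzero Betti number, which exists because M is
    bounded below (betti_zero_low), and m <= j. So the derived tensor product has
    cohomology in the degrees i + m and i + j + g + 1, which differ by at least
    g + 1. The choice of the resolution does not matter (nonnull_transfer).

    Lifting along quasi-isomorphisms, cancelling them, and comparing the
    truncations all rest on the homotopy fibre: K-projectivity makes maps to an
    acyclic fibre null homotopic, and these are maps with a null homotopy of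
    their composite (null_of_fib, lift_quasi_iso). *)

(** * Linear algebra in arbitrary dimension *)

Definition mk_linear (k : fieldType) (U V : lmodType k) (f : U -> V)
  (f_lin : linear f) : {linear U -> V} :=
  HB.pack f (GRing.isLinear.Build k U V *:%R f f_lin).

(** A maximal subspace among those meeting S trivially is a complement of S,
    and the projection along it is linear. *)
Lemma projector_exists (k : fieldType) (V : lmodType k) (S : {pred V}) :
  submod_closed S ->
  exists2 pr : {linear V -> V}, forall v, pr v \in S & forall v, v \in S -> pr v = v.
Proof.
move=> [S0 Slin].
have Sadd x y : x \in S -> y \in S -> x + y \in S.
  by move=> Sx Sy; rewrite -[x]scale1r Slin.
have Sscale a x : x \in S -> a *: x \in S.
  by move=> Sx; rewrite -[_ *: _]addr0 Slin.
pose indep (A : set V) := (forall a x y, A x -> A y -> A (a *: x + y)) /\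
  (forall x, A x -> x \in S -> x = 0).
have [A [[Alin A0] Amax]] : exists A, indep A /\ forall B, (A `<` B)%classic -> ~ indep B.
  apply: Zorn_bigcup => F Find Ftot; split.
    move=> a x y [X FX Xx] [Y FY Yy].
    have [XY|YX] := Ftot _ _ FX FY.
      by exists Y => //; apply: (Find _ FY).1 => //; apply: XY.
    by exists X => //; apply: (Find _ FX).1 => //; apply: YX.
  by move=> x [X FX Xx]; apply: (Find _ FX).2.
have Az : A 0.
  apply: contrapT => nA0; apply: (Amax [set x | A x \/ x = 0]%classic).
    split; first by move=> x; left.
    by move/(_ 0) => h; apply: nA0; apply: h; right.
  split=> [a x y /= [Ax|->] [Ay|->]|x /= [|//]]; last exact: A0.
  - by left; apply: Alin.
  - have [->|a0] := eqVneq a 0; first by right; rewrite scale0r addr0.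
    left; rewrite addr0.
    have -> : a *: x = (a - 1) *: x + x by rewrite scalerBl scale1r subrK.
    exact: Alin.
  - by left; rewrite scaler0 add0r.
  - by right; rewrite scaler0 addr0.
have dec v : exists s, s \in S /\ A (v - s).
  apply: contrapT => nv.
  pose B : set V := [set x | exists a y, A y /\ x = a *: v + y]%classic.
  apply: (Amax B).
    split; first by move=> x Ax; exists 0, x; rewrite scale0r add0r.
    move=> BA; apply: nv; exists 0; split=> //; rewrite subr0.
    by apply: BA; exists 1, 0; rewrite scale1r addr0.
  split=> [a _ _ [b [x [Ax ->]]] [c [y [Ay ->]]]|_ [a [y [Ay ->]]] Sx].
    exists (a * b + c), (a *: x + y); split; first exact: Alin.
    by rewrite scalerDr scalerA scalerDl addrACA.
  have [a0|a0] := eqVneq a 0.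
    by move: Sx; rewrite a0 scale0r add0r; apply: A0.
  case: nv; exists (a^-1 *: (a *: v + y)); split; first exact: Sscale.
  rewrite scalerDr scalerA mulVf // scale1r opprD addrA subrr add0r.
  rewrite -scaleNr -[_ *: y]addr0; exact: Alin.
pose pr v := projT1 (cid (dec v)).
have prP v : pr v \in S /\ A (v - pr v) by rewrite /pr; case: cid.
have prE v s : s \in S -> A (v - s) -> pr v = s.
  move=> Ss As; have [Sp Ap] := prP v; apply/eqP; rewrite -subr_eq0; apply/eqP.
  apply: A0.
    have -> : pr v - s = (-1) *: (v - pr v) + (v - s).
      by rewrite scaleN1r opprB addrA subrK.
    exact: Alin.
  by rewrite -scaleN1r Sadd // Sscale.
have pr_lin : linear pr.
  move=> a x y; apply: prE.
    by have [Sx _] := prP x; have [Sy _] := prP y; rewrite Slin.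
  have -> : a *: x + y - (a *: pr x + pr y) = a *: (x - pr x) + (y - pr y).
    by rewrite scalerBr opprD addrACA.
  by apply: Alin; [case: (prP x) | case: (prP y)].
exists (mk_linear pr_lin) => v /=; first by case: (prP v).
by move=> Sv; apply: prE => //; rewrite subrr.
Qed.

(** A linear map vanishing on the kernel of d is determined on the image of d,
    from which it extends along a projector. *)
Lemma linear_factor (k : fieldType) (U V W : lmodType k)
    (d : {linear U -> V}) (f : {linear U -> W}) :
  (forall u, d u = 0 -> f u = 0) ->
  exists g : {linear V -> W}, forall u, g (d u) = f u.
Proof.
move=> df; pose im : {pred V} := fun v => `[< exists u, v = d u >].
have [|pr pr_im prK] := @projector_exists k V im.
  split=> [|a x y /asboolP[u ->] /asboolP[u' ->]]; apply/asboolP.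
    by exists 0; rewrite linear0.
  by exists (a *: u + u'); rewrite linearP.
have ex v : exists u, pr v = d u by apply/asboolP; apply: pr_im.
pose s v := projT1 (cid (ex v)).
have sE v : d (s v) = pr v by rewrite /s; case: cid.
have fE u v : d u = pr v -> f (s v) = f u.
  move=> uv; apply/eqP; rewrite -subr_eq0 -linearB; apply/eqP; apply: df.
  by rewrite linearB /= sE uv subrr.
have g_lin : linear (f \o s).
  move=> a x y /=; rewrite -linearP; apply: fE.
  by rewrite !linearP /= !sE.
exists (mk_linear g_lin) => u /=; apply: fE.
by rewrite prK //; apply/asboolP; exists u.
Qed.

Lemma separating_functional (k : fieldType) (V : lmodType k) (S : {pred V}) v :
  submod_closed S -> v \notin S ->
  exists2 l : {linear V -> k^o}, forall s, s \in S -> l s = 0 & l v = 1.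
Proof.
move=> Ssub vS; have [pr prS prK] := projector_exists Ssub.
have w0 : v - pr v != 0.
  by apply: contra vS; rewrite subr_eq0 => /eqP->; apply: prS.
have d_lin : linear ((fun a => a *: (v - pr v)) : k^o -> V).
  by move=> a x y; rewrite scalerDl scalerA.
have id_lin : linear (id : k^o -> k^o) by [].
have [|g gE] := @linear_factor k k^o V k^o (mk_linear d_lin) (mk_linear id_lin).
  by move=> a /= /eqP; rewrite scaler_eq0 (negPf w0) orbF => /eqP.
have l_lin : linear ((fun x => g (x - pr x)) : V -> k^o).
  by move=> a x y; rewrite -linearP; congr (g _); rewrite linearP scalerBr opprD addrACA.
exists (mk_linear l_lin) => [s Ss|] /=; first by rewrite prK // subrr linear0.
by have := gE 1; rewrite /= scale1r.
Qed.

(** * Cohomology in terms of elements *)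

Section Elements.
Variables (k : fieldType).
Implicit Types (X Y : complex k) (j : int).

(** The degree of y is left free: its component of degree j - 1 serves as well. *)
Definition Hvanish X j := forall x : X, homog j x -> diff x = 0 ->
  exists y, x = diff y.

Definition Hinj X Y (f : chain_map X Y) j := forall x : X, homog j x -> diff x = 0 ->
  (exists y, f x = diff y) -> exists y, x = diff y.

Definition Hsurj X Y (f : chain_map X Y) j := forall y : Y, homog j y -> diff y = 0 ->
  exists x z, [/\ homog j x, diff x = 0 & y = f x + diff z].

Lemma comp_diffE X i (x : X) : comp i (diff x) = diff (comp (i - 1) x).
Proof. by rewrite (comp_diff (complexP X)) subrK. Qed.

Lemma boundary_homog X j (x y : X) : homog j x -> x = diff y ->
  exists2 z, homog (j - 1) z & x = diff z.
Proof.
move=> hx xy; exists (comp (j - 1) y); first exact: comp_homog.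
by rewrite -comp_diffE -xy hx.
Qed.

Lemma cocycleP X j (x : X) : reflect (homog j x /\ diff x = 0) (x \in @cocycle_pred k X j).
Proof. by apply: (iffP andP) => -[/eqP ? /eqP ?]. Qed.

Lemma lpi_boundary X j (z : cocycle X j) :
  lpi (@boundary_closed k X j) z = 0 <-> exists y, val z = diff y.
Proof.
have [hz _] : homog j (val z) /\ diff (val z) = 0 by apply/cocycleP; case: z.
rewrite lpi_eq0; split=> [/asboolP[y _ ->]|[y zy]]; first by exists y.
by apply/asboolP; apply: boundary_homog zy.
Qed.

Lemma Hvanish_trivial X j : trivial_space 'H^j(X) <-> Hvanish X j.
Proof.
split=> [Xj x hx dx|Xj h].
  have xc : x \in @cocycle_pred k X j by apply/cocycleP.
  by have /lpi_boundary := Xj (lpi (@boundary_closed k X j) (Cocycle xc)).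
rewrite -(lreprK h); apply/lpi_boundary.
by case: (lrepr h) => x /= /cocycleP[hx dx]; apply: Xj.
Qed.

Lemma Hvanish_acyclic X : (forall j, Hvanish X j) -> acyclic X.
Proof. by move=> h j; apply/Hvanish_trivial. Qed.

Lemma quasi_iso_Hinj X Y (f : chain_map X Y) : quasi_iso f -> forall j, Hinj f j.
Proof.
move=> qf j x hx dx [y fxy].
have xc : x \in @cocycle_pred k X j by apply/cocycleP.
apply/(lpi_boundary (Cocycle xc)); apply: (bij_inj (qf j)).
rewrite HmapE -(lpi0 (@boundary_closed k X j)) HmapE.
have -> : cocycle_map f (0 : cocycle X j) = 0 by apply: val_inj; rewrite /= linear0.
by rewrite lpi0; apply/lpi_boundary; exists y.
Qed.

Lemma quasi_iso_Hsurj X Y (f : chain_map X Y) : quasi_iso f -> forall j, Hsurj f j.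
Proof.
move=> qf j y hy dy.
have yc : y \in @cocycle_pred k Y j by apply/cocycleP.
have [h _ hK] := qf j; have := hK (lpi (@boundary_closed k Y j) (Cocycle yc)).
rewrite -[h _]lreprK HmapE; case: (lrepr _) => x xc.
move/esym/lpi_eq/asboolP => [z _ /= yz].
have /cocycleP[hx dx] := xc.
by exists x, z; split=> //; rewrite -yz addrC subrK.
Qed.

Lemma sgnK i : sgn k i * sgn k i = 1.
Proof. by rewrite /sgn -expfzMl mulrNN mulr1 exp1rz. Qed.

Section Twist.
Variable X : complex k.

(** The grading involution x |-> (-1)^|x| x. *)
Definition twist : X -> X := gsum (fun i => GRing.scale (sgn k i)).
HB.instance Definition _ := GRing.isLinear.Build k X X *:%R twist (gsum_linear _).

Lemma twist0 : twist 0 = 0. Proof. exact: linear0. Qed.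
Lemma twistD x y : twist (x + y) = twist x + twist y. Proof. exact: linearD. Qed.
Lemma twistZ a x : twist (a *: x) = a *: twist x. Proof. exact: linearZ_LR. Qed.

Lemma twistE i x : homog i x -> twist x = sgn k i *: x.
Proof. by move=> hx; rewrite /twist (gsum_homog _ hx). Qed.

Lemma twistK : involutive twist.
Proof.
elim/homog_ind => [|x y IHx IHy|i x hx]; first by rewrite !twist0.
  by rewrite !twistD IHx IHy.
by rewrite (twistE hx) twistZ (twistE hx) scalerA sgnK scale1r.
Qed.

Lemma diff_twist x : diff (twist x) = - twist (diff x).
Proof.
elim/homog_ind: x => [|x y IHx IHy|i x hx]; first by rewrite !(twist0, linear0).
  by rewrite !(twistD, linearD) IHx IHy.
rewrite (twistE hx) (twistE (diff_homog hx)) linearZ_LR sgnS scaleNr.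
by rewrite opprK.
Qed.

Lemma comp_twist i x : comp i (twist x) = twist (comp i x).
Proof.
elim/homog_ind: x => [|x y IHx IHy|j x hx]; first by rewrite !(twist0, linear0).
  by rewrite !(twistD, linearD) IHx IHy.
rewrite (twistE hx) linearZ_LR /= (comp_homogE _ hx).
by case: eqP => _; rewrite ?(twistE hx) // scaler0 twist0.
Qed.

Lemma homog_twist i x : homog i x -> homog i (twist x).
Proof. by rewrite /homog comp_twist => ->. Qed.

End Twist.

(** The cohomology class of the degree j part of an element, its cocycle part
    being singled out by a projector. *)
Lemma class_map X j : exists c : {linear X -> 'H^j(X)},
  [/\ forall z : cocycle X j, c (val z) = lpi (@boundary_closed k X j) z
    & forall x, c (comp j x) = c x].
Proof.
have [pr prZ prK] := projector_exists (@cocycle_closed k X j).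
pose z x : cocycle X j := Cocycle (prZ (comp j x)).
have c_lin : linear (fun x => lpi (@boundary_closed k X j) (z x)).
  move=> a x y; rewrite -linearP; congr (lpi _ _); apply: val_inj.
  by rewrite /= !linearP.
exists (mk_linear c_lin); split=> [z0|x] /=; congr (lpi _ _); apply: val_inj => /=.
  have zc : val z0 \in @cocycle_pred k X j by case: z0.
  by have /cocycleP[hz _] := zc; rewrite hz prK.
by rewrite (comp_homogE _ (comp_homog j x)) eqxx.
Qed.

End Elements.

(** * Shifts, fibres and homotopies of DG modules *)

Section Modules.
Variables (k : fieldType) (R : dga k).

Notation RX := (dga_cx R).

Lemma twist1 : twist (1 : RX) = 1 :> R.
Proof.
have h1 : homog 0 (1 : RX) by exact: dga_comp1.
by rewrite (twistE h1) [sgn k 0]expr0z scale1r.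
Qed.

Lemma twistM (r s : R) :
  twist (r * s : RX) = (twist (r : RX) : R) * (twist (s : RX) : R) :> R.
Proof.
elim/(@homog_ind k RX): r => [|r r' IHr IHr'|i r hr].
- by rewrite mul0r twist0 mul0r.
- by rewrite mulrDl !(@twistD _ RX) IHr IHr' mulrDl.
elim/(@homog_ind k RX): s => [|s s' IHs IHs'|j s hs].
- by rewrite mulr0 twist0 mulr0.
- by rewrite mulrDr !(@twistD _ RX) IHs IHs' mulrDr.
rewrite (twistE hr) (twistE hs) (@twistE _ RX (i + j)); last exact: dga_homogM.
by rewrite -scalerAl -scalerAr scalerA sgnD.
Qed.

Section Action.
Variable M : dglmod R.
Implicit Types (r : R) (x : M).

Lemma lactZl a r x : lact (a *: r) x = a *: lact r x.
Proof. by have := lact_linl x a r 0; rewrite lact0l !addr0. Qed.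

Lemma lactNr r x : lact r (- x) = - lact r x.
Proof. by rewrite -scaleN1r lactZr scaleN1r. Qed.

Lemma lactNl r x : lact (- r) x = - lact r x.
Proof. by rewrite -(@scaleN1r k R r) lactZl scaleN1r. Qed.

End Action.

Lemma dgl_map_ex (M N : dglmod R) (f : M -> N) :
  linear f -> (forall i x, f (comp i x) = comp i (f x)) ->
  (forall x, f (diff x) = diff (f x)) ->
  (forall r x, f (lact r x) = lact r (f x)) ->
  exists F : dgl_map M N, F =1 f.
Proof.
move=> f_lin f_comp f_diff f_lact.
pose F0 : chain_map M N := @ChainMap k M N (mk_linear f_lin) f_comp f_diff.
by exists (@DGLMap k R M N F0 f_lact).
Qed.

Section Shift.
Variable M : dglmod R.

Definition shift_comp (i : int) : {linear M -> M} := comp (i + 1).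

Definition shift_diff (x : M) : M := - diff x.
Fact shift_diff_linear : linear shift_diff.
Proof. by move=> a x y; rewrite /shift_diff linearP opprD scalerN. Qed.
HB.instance Definition _ := GRing.isLinear.Build k M M *:%R shift_diff shift_diff_linear.

Fact shift_is_complex : is_complex shift_comp shift_diff.
Proof.
split=> [i j x|x|i x|x]; rewrite /shift_comp /shift_diff.
- by rewrite (comp_comp (complexP M)) (inj_eq (addIr _)).
- have [s us xs] := comp_sum (complexP M) x.
  exists (map (fun i => i - 1) s); first by rewrite map_inj_uniq //; apply: addIr.
  by rewrite big_map {1}xs; apply: eq_bigr => i _; rewrite subrK.
- by rewrite linearN comp_diffE addrK.
- by rewrite linearN opprK (diff_diff (complexP M)).
Qed.

Definition shift_cx : complex k := Complex shift_is_complex.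

Definition shift_lact (r : R) (x : shift_cx) : shift_cx := lact (twist (r : RX) : R) (x : M).

Fact shift_linl (x : shift_cx) : linear (shift_lact^~ x).
Proof. by move=> a r s; rewrite /shift_lact linearP lactDl lactZl. Qed.
Fact shift_linr r : linear (shift_lact r).
Proof. by move=> a x y; apply: lact_linr. Qed.
Fact shift_lact1 x : shift_lact 1 x = x.
Proof. by rewrite /shift_lact twist1 lact1. Qed.
Fact shift_lactM r s x : shift_lact (r * s) x = shift_lact r (shift_lact s x).
Proof. by rewrite /shift_lact twistM lactM. Qed.
Fact shift_homog i j (r : RX) (x : shift_cx) :
  homog i r -> homog j x -> homog (i + j) (shift_lact r x).
Proof.
move=> hr hx; rewrite /homog /= /shift_comp -addrA.
exact: (lact_homog (homog_twist hr) hx).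
Qed.
Fact shift_leibniz i (r : RX) (x : shift_cx) : homog i r ->
  diff (shift_lact r x) = shift_lact (diff r) x + sgn k i *: shift_lact r (diff x).
Proof.
move=> hr; rewrite /= /shift_diff /shift_lact (lact_leibniz _ (homog_twist hr)).
by rewrite diff_twist lactNl lactNr scalerN opprD opprK.
Qed.

Definition shift : dglmod R := DGLMod shift_linl shift_linr shift_lact1 shift_lactM
  shift_homog shift_leibniz.

End Shift.

Section Fibre.
Variables (A B : dglmod R) (f : dgl_map A B).

(* The sign in the action and the shift by one on the component in B are those
   of a homotopy: a map into the fibre consists of a map to A and a null
   homotopy of its composite with f. *)

Notation AB := (A * B)%type.

Definition fib_comp_fun (i : int) (x : AB) : AB := (comp i x.1, comp (i - 1) x.2).
Fact fib_comp_linear i : linear (fib_comp_fun i).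
Proof. by move=> a x y; rewrite /fib_comp_fun !linearP. Qed.
HB.instance Definition _ i :=
  GRing.isLinear.Build k AB AB *:%R (fib_comp_fun i) (fib_comp_linear i).
Definition fib_comp i : {linear AB -> AB} := fib_comp_fun i.

Definition fib_diff (x : AB) : AB := (diff x.1, f x.1 - diff x.2).
Fact fib_diff_linear : linear fib_diff.
Proof.
move=> a x y; rewrite /fib_diff !linearP /=; congr (_, _).
by rewrite addrACA -scalerDr.
Qed.
HB.instance Definition _ := GRing.isLinear.Build k AB AB *:%R fib_diff fib_diff_linear.

Lemma pair_sum (I : Type) (s : seq I) (F : I -> AB) :
  \sum_(i <- s) F i = (\sum_(i <- s) (F i).1, \sum_(i <- s) (F i).2).
Proof.
elim: s => [|i s IH]; first by rewrite !big_nil.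
by rewrite !big_cons IH.
Qed.

Lemma supp_sum_sub (X : complex k) (x : X) (s : seq int) : uniq s ->
  {subset supp x <= s} -> x = \sum_(i <- s) comp i x.
Proof.
move=> us ss; rewrite [LHS]supp_sum.
exact: (@gsumE k X X (fun=> idfun)).
Qed.

Fact fib_is_complex : is_complex fib_comp fib_diff.
Proof.
split=> [i j [x y]|[x y]|i [x y]|[x y]] /=.
- rewrite /fib_comp_fun /= !(comp_comp (complexP _)) (inj_eq (addIr _)).
  by case: eqP.
- pose s := undup (supp x ++ map (fun i => i + 1) (supp y)).
  have us : uniq s by apply: undup_uniq.
  exists s => //; rewrite pair_sum /=; congr (_, _).
    by apply: supp_sum_sub => // i xi; rewrite mem_undup mem_cat xi.
  rewrite -(big_map (fun i => i - 1) xpredT (fun i => comp i y)).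
  apply: supp_sum_sub; first by rewrite map_inj_uniq //; apply: addIr.
  move=> i yi; apply/mapP; exists (i + 1); rewrite ?addrK //.
  by rewrite mem_undup mem_cat (map_f (fun i => i + 1)) ?orbT.
- rewrite /fib_comp_fun /fib_diff /= !linearB /= -!(cm_comp f).
  by rewrite !(comp_diff (complexP _)) subrK addrK.
- rewrite /fib_diff /= raddfB /= !(diff_diff (complexP _)) cm_diff.
  by rewrite subr0 subrr.
Qed.

Definition fib_cx : complex k := Complex fib_is_complex.

Definition fib_lact (r : R) (x : fib_cx) : fib_cx :=
  (lact r x.1, lact (twist (r : RX) : R) x.2).

Fact fib_linl (x : fib_cx) : linear (fib_lact^~ x).
Proof.
move=> a r s; rewrite /fib_lact linearP !lactDl !lactZl.
by [].
Qed.
Fact fib_linr r : linear (fib_lact r).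
Proof. by move=> a x y; rewrite /fib_lact !lact_linr. Qed.
Fact fib_lact1 x : fib_lact 1 x = x.
Proof. by rewrite /fib_lact twist1 !lact1; case: x. Qed.
Fact fib_lactM r s x : fib_lact (r * s) x = fib_lact r (fib_lact s x).
Proof. by rewrite /fib_lact twistM !lactM. Qed.
Fact fib_homog i j (r : RX) (x : fib_cx) :
  homog i r -> homog j x -> homog (i + j) (fib_lact r x).
Proof.
case: x => x y hr [hx hy]; rewrite /homog /= /fib_comp_fun /fib_lact /=.
congr (_, _); first exact: (lact_homog hr hx).
rewrite -addrA; exact: (lact_homog (homog_twist hr) hy).
Qed.
Fact fib_leibniz i (r : RX) (x : fib_cx) : homog i r ->
  diff (fib_lact r x) = fib_lact (diff r) x + sgn k i *: fib_lact r (diff x).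
Proof.
case: x => x y hr; rewrite /= /fib_diff /fib_lact /=; congr (_, _).
  by rewrite (lact_leibniz _ hr).
rewrite dglm_lact (lact_leibniz _ (homog_twist hr)) diff_twist lactNl.
rewrite (twistE hr) !lactZl lactDr lactNr.
rewrite scalerA sgnK scale1r.
rewrite [RHS](_ : _ = lact (twist (diff r) : R) y +
  sgn k i *: (sgn k i *: (lact r (f x) - lact r (diff y)))) //.
by rewrite scalerA sgnK scale1r opprD opprK addrCA.
Qed.

Definition fib : dglmod R := DGLMod fib_linl fib_linr fib_lact1 fib_lactM
  fib_homog fib_leibniz.

(** The long exact sequence of the fibre, around degree j. *)
Lemma Hvanish_fib j : Hinj f j -> Hsurj f (j - 1) -> Hvanish fib j.
Proof.
move=> fi fs [a b] [ha hb] [da fab].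
have [|a' aa'] := fi a ha da; first by exists b; apply/eqP; rewrite -subr_eq0 fab.
have [a1 ha1 aa1] := boundary_homog ha aa'.
have [||x [z [hx dx bz]]] := fs (f a1 - b).
- by rewrite /homog linearB /= hb -cm_comp ha1.
- by rewrite linearB /= -cm_diff -aa1.
exists (a1 - x, z : B); rewrite /= /fib_diff /= linearB /= dx subr0 -aa1.
by congr (_, _); rewrite linearB /= -addrA -opprD -bz subKr.
Qed.

End Fibre.

Section Composition.
Implicit Types (A B C : dglmod R).

Definition dgl_comp A B C (g : dgl_map B C) (f : dgl_map A B) : dgl_map A C :=
  @DGLMap k R A C
    (@ChainMap k A C (g \o f)
      (fun i x => etrans (congr1 g (cm_comp f i x)) (cm_comp g i (f x)))
      (fun x => etrans (congr1 g (cm_diff f x)) (cm_diff g (f x))))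
    (fun r x => etrans (congr1 g (dglm_lact f r x)) (dglm_lact g r (f x))).

Definition dgl_id A : dgl_map A A :=
  @DGLMap k R A A (@ChainMap k A A idfun (fun i x => erefl) (fun x => erefl))
    (fun r x => erefl).

Lemma dgl_sub_subproof A B (f g : dgl_map A B) :
  exists h : dgl_map A B, forall x, h x = f x - g x.
Proof.
apply: dgl_map_ex => [a x y|i x|x|r x].
- by rewrite !linearP addrACA -scalerDr.
- by rewrite !cm_comp linearB.
- by rewrite !cm_diff linearB.
- by rewrite !dglm_lact lactDr lactNr.
Qed.

Definition dgl_sub A B (f g : dgl_map A B) : dgl_map A B :=
  projT1 (cid (dgl_sub_subproof f g)).

Lemma dgl_subE A B (f g : dgl_map A B) x : dgl_sub f g x = f x - g x.
Proof. by rewrite /dgl_sub; case: cid. Qed.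

Definition homotopic A B (f g : dgl_map A B) : Prop := null_homotopic (dgl_sub f g).

Lemma null_homotopic_eq A B (f g : dgl_map A B) :
  f =1 g -> null_homotopic f -> null_homotopic g.
Proof. by move=> fg [h [h1 h2 h3]]; exists h; split=> // x; rewrite -fg. Qed.

Lemma null_compl A B C (g : dgl_map B C) (f : dgl_map A B) :
  null_homotopic f -> null_homotopic (dgl_comp g f).
Proof.
move=> [h [h_homog h_lact hE]]; exists (g \o h); split=> [i x hx|i r x hr|x] /=.
- by rewrite /homog -cm_comp h_homog.
- by rewrite (h_lact _ _ _ hr) linearZ_LR dglm_lact.
- by rewrite hE linearD cm_diff.
Qed.

Lemma null_compr A B C (g : dgl_map B C) (f : dgl_map A B) :
  null_homotopic g -> null_homotopic (dgl_comp g f).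
Proof.
move=> [h [h_homog h_lact hE]]; exists (h \o f); split=> [i x hx|i r x hr|x] /=.
- by apply: h_homog; rewrite /homog -cm_comp hx.
- by rewrite dglm_lact (h_lact _ _ _ hr).
- by rewrite hE cm_diff.
Qed.

Lemma null_sub A B (f g : dgl_map A B) :
  null_homotopic f -> null_homotopic g -> null_homotopic (dgl_sub f g).
Proof.
move=> [h [h_homog h_lact hE]] [h' [h'_homog h'_lact h'E]].
have hh_lin : linear (fun x => h x - h' x).
  by move=> a x y; rewrite !linearP addrACA -scalerDr.
exists (mk_linear hh_lin); split=> [i x hx|i r x hr|x] /=.
- by rewrite /homog linearB /= h_homog ?h'_homog.
- by rewrite (h_lact _ _ _ hr) (h'_lact _ _ _ hr) lactDr lactNr scalerBr.
- by rewrite dgl_subE hE h'E linearB /= opprD addrACA.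
Qed.

Lemma homotopic_null A B (f g : dgl_map A B) :
  homotopic f g -> null_homotopic f -> null_homotopic g.
Proof.
move=> fg f0; apply: null_homotopic_eq (null_sub f0 fg) => x.
by rewrite !dgl_subE subKr.
Qed.

Lemma homotopic_sym A B (f g : dgl_map A B) : homotopic f g -> homotopic g f.
Proof.
move=> fg; apply: null_homotopic_eq (null_sub (null_sub fg fg) fg) => x.
by rewrite !dgl_subE subrr sub0r opprB.
Qed.

Lemma homotopic_compl A B C (g : dgl_map B C) (f f' : dgl_map A B) :
  homotopic f f' -> homotopic (dgl_comp g f) (dgl_comp g f').
Proof.
move/(null_compl g); apply: null_homotopic_eq => x.
by rewrite /= !dgl_subE linearB.
Qed.

Lemma homotopic_compr A B C (g g' : dgl_map B C) (f : dgl_map A B) :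
  homotopic g g' -> homotopic (dgl_comp g f) (dgl_comp g' f).
Proof.
move/(null_compr f); apply: null_homotopic_eq => x.
by rewrite /= !dgl_subE.
Qed.

Lemma homotopic_trans A B (f g h : dgl_map A B) :
  homotopic f g -> homotopic g h -> homotopic f h.
Proof.
move=> fg /homotopic_sym hg; apply: null_homotopic_eq (null_sub fg hg) => x.
by rewrite !dgl_subE opprB addrA subrK.
Qed.

End Composition.

Section Homotopy.
Variables (F : dglmod R) (F_proj : K_projective F).
Implicit Types (A B C : dglmod R).

Lemma homotopy_comp A B (h : {linear A -> B}) :
  (forall i x, homog i x -> homog (i - 1) (h x)) ->
  forall i x, h (comp i x) = comp (i - 1) (h x).
Proof.
move=> hh i; elim/homog_ind => [|x y IHx IHy|j x hx]; first by rewrite !linear0.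
  by rewrite !linearD IHx IHy.
rewrite (comp_homogE _ hx) (comp_homogE _ (hh _ _ hx)) (inj_eq (addIr _)).
by case: eqP; rewrite ?linear0.
Qed.

Lemma homotopy_lact A B (h : {linear A -> B}) :
  (forall i (r : RX) x, homog i r -> h (lact r x) = sgn k i *: lact r (h x)) ->
  forall r x, h (lact r x) = lact (twist (r : RX) : R) (h x).
Proof.
move=> hh r x; elim/(@homog_ind k RX): r => [|r s IHr IHs|i r hr].
- by rewrite lact0l !linear0 lact0l.
- by rewrite lactDl !linearD IHr IHs lactDl.
by rewrite (hh _ _ _ hr) (twistE hr) lactZl.
Qed.

(** A null homotopy of the composite of w with i lifts w to the fibre of i, and
    a null homotopy of the lift restricts to one of w. *)
Lemma null_of_fib A B (i : dgl_map A B) (w : dgl_map F A) :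
  (forall g : dgl_map F (fib i), null_homotopic g) ->
  null_homotopic (dgl_comp i w) -> null_homotopic w.
Proof.
move=> fib0 [h [h_homog h_lact hE]].
pose v x : fib i := (w x, h x).
have [||||g gE] := @dgl_map_ex F (fib i) v.
- by move=> a x y; rewrite /v !linearP.
- by move=> j x; rewrite /v cm_comp (homotopy_comp h_homog).
- by move=> x; rewrite /v /= /fib_diff /= [i _]hE cm_diff addrAC subrr add0r.
- by move=> r x; rewrite /v /= /fib_lact /= dglm_lact (homotopy_lact h_lact).
have [H [H_homog H_lact HE]] := fib0 g.
have H1_lin : linear (fun x => (H x).1) by move=> a x y; rewrite linearP.
exists (mk_linear H1_lin); split=> [j x hx|j r x hr|x] /=.
- exact: (congr1 fst (H_homog _ _ hx)).
- by rewrite (H_lact _ _ _ hr).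
by have := HE x; rewrite gE => /(congr1 fst).
Qed.

(** The fibre of a quasi-isomorphism is acyclic. *)
Lemma null_cancel A B (i : dgl_map A B) (w : dgl_map F A) :
  (forall j, Hinj i j) -> (forall j, Hsurj i j) ->
  null_homotopic (dgl_comp i w) -> null_homotopic w.
Proof.
move=> ii is_; apply: null_of_fib => g; apply: F_proj.
by apply: Hvanish_acyclic => j; apply: Hvanish_fib.
Qed.

Fact shift_map_diff A B (f : dgl_map A B) (x : shift A) :
  f (diff x : shift A) = diff (f x : shift B).
Proof. by rewrite /= /shift_diff linearN cm_diff. Qed.

Definition shift_map A B (f : dgl_map A B) : dgl_map (shift A) (shift B) :=
  @DGLMap k R (shift A) (shift B)
    (@ChainMap k (shift A) (shift B) f (fun i => cm_comp f (i + 1)) (shift_map_diff f))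
    (fun r x => dglm_lact f (twist (r : RX)) x).

(** The lift is one component of a null homotopy of the map (0, b) into the
    cone of i, that is, into the fibre of the shifted map. *)
Lemma lift_quasi_iso A B (i : dgl_map A B) (b : dgl_map F B) :
  (forall j, Hinj i j) -> (forall j, Hsurj i j) ->
  exists a : dgl_map F A, homotopic b (dgl_comp i a).
Proof.
move=> ii is_; pose C := fib (shift_map i).
pose v x : C := (0 : A, b x).
have [||||g gE] := @dgl_map_ex F C v.
- move=> a x y; rewrite /v linearP.
  rewrite [RHS](_ : _ = (a *: (0 : A) + 0, a *: b x + b y)) //.
  by rewrite scaler0 addr0.
- move=> j x; rewrite /v /= /fib_comp_fun /= /shift_comp subrK linear0.
  by rewrite cm_comp.
- move=> x; rewrite /v /= /fib_diff /= /shift_diff !linear0 add0r opprK.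
  by rewrite cm_diff.
- move=> r x; rewrite /v /= /fib_lact /= /shift_lact twistK lact0r.
  by rewrite dglm_lact.
have [|H [H_homog H_lact HE]] := F_proj g.
  apply: Hvanish_acyclic => j; apply: Hvanish_fib.
    move=> x hx dx [y ixy]; have [||y' xy'] := ii (j + 1) x hx.
    - by apply/eqP; rewrite -oppr_eq0; apply/eqP.
    - by exists (- y); rewrite linearN.
    by exists (- y'); rewrite /= /shift_diff linearN opprK.
  move=> y hy dy; have [|x [z [hx dx yE]]] := is_ (j - 1 + 1) y hy.
    by apply/eqP; rewrite -oppr_eq0; apply/eqP.
  exists x, (- z); split=> //=; first by rewrite /shift_diff dx oppr0.
  by rewrite /shift_diff linearN opprK.
have H1c := homotopy_comp H_homog; have H1l := homotopy_lact H_lact.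
have [|||| a aE] := @dgl_map_ex F A (fun x => (H x).1).
- by move=> c x y; rewrite linearP.
- by move=> j x; rewrite H1c /= /fib_comp_fun /= /shift_comp subrK.
- move=> x; have := HE x; rewrite gE => /(congr1 fst) /= /esym/eqP.
  by rewrite addrC /shift_diff subr_eq0 => /eqP.
- move=> r x; rewrite H1l /= /fib_lact /= /shift_lact twistK.
  by [].
exists a; have H2_lin : linear (fun x => (H x).2).
  by move=> c x y; rewrite linearP.
exists (mk_linear H2_lin); split=> [j x hx|j r x hr|x] /=.
- have := congr1 snd (H_homog _ _ hx); rewrite /= /shift_comp.
  by rewrite subrK.
- rewrite (H_lact _ _ _ hr) /= /fib_lact /= /shift_lact twistK.
  by [].
have := HE x; rewrite gE => /(congr1 snd) /= bE; rewrite dgl_subE bE /= aE.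
by rewrite /shift_diff opprK [_ + diff _]addrC addrAC addrK.
Qed.

End Homotopy.

End Modules.

(** * Truncations and modules with few cohomology groups *)

Section Submodule.
Variables (k : fieldType) (R : dga k) (Q : dglmod R) (S : {pred Q}).
Hypotheses (S_sub : submod_closed S)
  (S_comp : forall i x, x \in S -> comp i x \in S)
  (S_diff : forall x, x \in S -> diff x \in S)
  (S_lact : forall r x, x \in S -> lact r x \in S).

Record sub_dg := SubDG { sub_val : Q; _ : sub_val \in submod_pred S_sub }.
HB.instance Definition _ := [isSub for sub_val].
HB.instance Definition _ := [Choice of sub_dg by <:].
HB.instance Definition _ := [SubChoice_isSubLmodule of sub_dg by <:].

Definition sub_comp_fun i (x : sub_dg) : sub_dg := SubDG (S_comp i (valP x)).
Fact sub_comp_linear i : linear (sub_comp_fun i).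
Proof. by move=> a x y; apply: val_inj; rewrite /= !linearP. Qed.
HB.instance Definition _ i :=
  GRing.isLinear.Build k sub_dg sub_dg *:%R (sub_comp_fun i) (sub_comp_linear i).
Definition sub_comp i : {linear sub_dg -> sub_dg} := sub_comp_fun i.

Definition sub_diff (x : sub_dg) : sub_dg := SubDG (S_diff (valP x)).
Fact sub_diff_linear : linear sub_diff.
Proof. by move=> a x y; apply: val_inj; rewrite /= !linearP. Qed.
HB.instance Definition _ :=
  GRing.isLinear.Build k sub_dg sub_dg *:%R sub_diff sub_diff_linear.

Fact sub_is_complex : is_complex sub_comp sub_diff.
Proof.
split=> [i j x|x|i x|x].
- by apply: val_inj; rewrite /= (comp_comp (complexP Q)); case: eqP.
- have [s us xs] := comp_sum (complexP Q) (val x); exists s => //.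
  by apply: val_inj; rewrite raddf_sum.
- by apply: val_inj; rewrite /= (comp_diff (complexP Q)).
- by apply: val_inj; rewrite /= (diff_diff (complexP Q)).
Qed.

Definition sub_cx : complex k := Complex sub_is_complex.

Lemma homog_sub i (x : sub_cx) : homog i x <-> homog i (val x : Q).
Proof. by split=> [/(congr1 val)|h]; last apply: val_inj. Qed.

Definition sub_lact (r : R) (x : sub_cx) : sub_cx := SubDG (S_lact r (valP x)).

Fact sub_linl (x : sub_cx) : linear (sub_lact^~ x).
Proof. by move=> a r s; apply: val_inj; rewrite /= lact_linl. Qed.
Fact sub_linr r : linear (sub_lact r).
Proof. by move=> a x y; apply: val_inj; rewrite /= lact_linr. Qed.
Fact sub_lact1 x : sub_lact 1 x = x.
Proof. by apply: val_inj; rewrite /= lact1. Qed.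
Fact sub_lactM r s x : sub_lact (r * s) x = sub_lact r (sub_lact s x).
Proof. by apply: val_inj; rewrite /= lactM. Qed.
Fact sub_homog i j (r : dga_cx R) (x : sub_cx) :
  homog i r -> homog j x -> homog (i + j) (sub_lact r x).
Proof. by move=> hr /homog_sub hx; apply/homog_sub/lact_homog. Qed.
Fact sub_leibniz i (r : dga_cx R) (x : sub_cx) : homog i r ->
  diff (sub_lact r x) = sub_lact (diff r) x + sgn k i *: sub_lact r (diff x).
Proof. by move=> hr; apply: val_inj; rewrite /= (lact_leibniz _ hr). Qed.

Definition submodule : dglmod R := DGLMod sub_linl sub_linr sub_lact1 sub_lactM
  sub_homog sub_leibniz.

Lemma submodule_incl : exists i : dgl_map submodule Q, i =1 val.
Proof. exact: (@dgl_map_ex k R submodule Q val). Qed.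

End Submodule.

Section Connected.
Variables (k : fieldType) (R : dga k) (R_conn : connected R).

Lemma lact_deg0 (M : dglmod R) (r : dga_cx R) (x : M) : homog 0 r ->
  lact r x = aug r *: x.
Proof.
move=> hr; have rE : r = (aug r)%:A :> R by rewrite -(augE R_conn) hr.
by rewrite [in LHS]rE lactZl lact1.
Qed.

(** In degree 0 the ring R only contributes scalars, so stability under R is to be
    checked in positive degrees. *)
Lemma lact_stable (M : dglmod R) (S : {pred M}) (r : dga_cx R) x :
  submod_closed S -> (forall l s, 0 < l -> homog l (s : dga_cx R) -> lact s x \in S) ->
  x \in S -> lact r x \in S.
Proof.
move=> [S0 Slin] Spos Sx; elim/(@homog_ind k (dga_cx R)): r => [|r s IHr IHs|l r hr].
- by rewrite lact0l.
- by rewrite lactDl -[lact r x]scale1r Slin.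
have [l0|l0|l0] := ltgtP l 0.
- by rewrite (conn_neg R_conn l0 hr) lact0l.
- exact: Spos l0 hr.
- by rewrite l0 in hr; rewrite lact_deg0 // -[_ *: _]addr0 Slin.
Qed.

(** In degree a the truncation keeps a complement of the coboundaries only, so
    that the cohomology in degrees >= a is unchanged. As R^0 = k this is stable
    under R. *)
Lemma truncation (Q : dglmod R) (a : int) :
  exists (T : dglmod R) (i : dgl_map T Q),
    [/\ forall j (x : T), j < a -> homog j x -> x = 0,
        forall j, Hinj i j & forall j, a <= j -> Hsurj i j].
Proof.
pose B : {pred Q} := fun x => `[< exists2 y, homog (a - 1) y & x = diff y >].
have B_homog x : x \in B -> homog a x.
  by move/asboolP => [y hy ->]; rewrite -[a](subrK 1); apply: diff_homog.
have [|pr prB prK] := @projector_exists k Q B.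
  split=> [|c x y /asboolP[u hu ->] /asboolP[v hv ->]]; apply/asboolP.
    by exists 0; rewrite ?linear0 //; apply: homog0.
  by exists (c *: u + v); [apply: homog_lin | rewrite linearP].
(* The kernel of the projector onto B is the complement kept in degree a. *)
pose S : {pred Q} := fun x => `[< (forall i, i < a -> comp i x = 0) /\ pr (comp a x) = 0 >].
have S_sub : submod_closed S.
  split=> [|c x y /asboolP[x0 x1] /asboolP[y0 y1]]; apply/asboolP.
    by split=> [i _|]; rewrite !linear0.
  split=> [i ia|]; first by rewrite linearP /= x0 // y0 // scaler0 addr0.
  by rewrite !linearP /= x1 y1 scaler0 addr0.
have S_gt x j : a < j -> homog j x -> x \in S.
  move=> aj hx; apply/asboolP; split=> [i ia|]; rewrite (comp_homogE _ hx).
    by rewrite lt_eqF // (lt_trans ia).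
  by rewrite lt_eqF // linear0.
have S_sum x : (forall i, i <= a -> comp i x = 0) -> x \in S.
  move=> h; apply/asboolP; split=> [i ia|]; first by rewrite h // ltW.
  by rewrite h // linear0.
have S_comp i x : x \in S -> comp i x \in S.
  move=> /asboolP[x0 x1]; apply/asboolP; split=> [j ja|].
    by rewrite (comp_comp (complexP Q)); case: eqP => // ji; rewrite -ji x0.
  by rewrite (comp_comp (complexP Q)); case: eqP => [<-|_] //; rewrite linear0.
have S_diff x : x \in S -> diff x \in S.
  move=> /asboolP[x0 _]; apply: S_sum => i ia; rewrite comp_diffE x0 ?linear0 //.
  by rewrite ltrBlDr ltzD1.
have S_lact r x : x \in S -> lact r x \in S.
  move=> Sx; apply: lact_stable => // l s l0 hs; apply: S_sum => i ia.
  rewrite (lact_comp _ _ hs); case/asboolP: Sx => x0 _.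
  by rewrite x0 ?lact0r // ltrBlDr (le_lt_trans ia) // ltrDl.
pose T := submodule S_sub S_comp S_diff S_lact.
have [i iE] := submodule_incl S_sub S_comp S_diff S_lact.
pose mkT x (Sx : x \in S) : T := SubDG (S_sub := S_sub) Sx.
have Tlow j (x : T) : j < a -> homog j x -> x = 0.
  move=> ja /homog_sub hx; apply: val_inj => /=; rewrite -hx.
  by case: x hx => x /= /asboolP[x0 _] _; apply: x0.
exists T, i; split=> // [j x hx dx [y ixy]|j aj y hy dy].
  have [ja|ja] := ltP j a; first by exists 0; rewrite linear0; apply: (Tlow j).
  have /homog_sub hix := hx; move: ixy; rewrite iE => ixy.
  have [z hz xz] := boundary_homog hix ixy.
  have [ja'|ja'] := eqVneq j a.
    have Bx : val x \in B by apply/asboolP; exists z => //; rewrite -ja'.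
    exists 0; rewrite linear0; apply: val_inj => /=; rewrite -(prK _ Bx).
    have /asboolP[_] : val x \in S by case: (x).
    by rewrite (B_homog _ Bx).
  have {ja'} ja : a < j by rewrite lt_neqAle eq_sym ja'.
  pose z' := z - pr (comp a z).
  have Sz : z' \in S.
    apply/asboolP; split=> [m ma|]; last first.
      by rewrite /z' !linearB /= (B_homog _ (prB _)) (prK _ (prB (comp a z))) subrr.
    have mj : m < j - 1 by rewrite (lt_le_trans ma) // lerBrDr lezD1.
    rewrite linearB /= (comp_homogE m hz) (comp_homogE m (B_homog _ (prB _))).
    by rewrite (lt_eqF mj) (lt_eqF ma) subr0.
  exists (mkT _ Sz); apply: val_inj => /=; rewrite linearB /= -xz.
  have /asboolP[u _ ->] := prB (comp a z).
  by rewrite (diff_diff (complexP Q)) subr0.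
have [ja|ja] := eqVneq j a; last first.
  have Sy : y \in S by apply: (S_gt _ j) => //; rewrite lt_neqAle eq_sym ja.
  exists (mkT _ Sy), 0; rewrite iE linear0 addr0; split=> //.
    exact/homog_sub.
  exact: val_inj.
subst j.
have Sy : y - pr y \in S.
  have hy' : homog a (y - pr y) by rewrite /homog linearB /= hy (B_homog _ (prB y)).
  apply/asboolP; split=> [m ma|]; first by rewrite (comp_homogE _ hy') lt_eqF.
  by rewrite hy' linearB /= (prK _ (prB y)) subrr.
have /asboolP[z _ prE] := prB y.
exists (mkT _ Sy), z; rewrite iE -prE subrK; split=> //.
  apply/homog_sub; rewrite /= /homog linearB /= hy.
  by rewrite (B_homog _ (prB y)).
apply: val_inj; rewrite /= linearB /= dy prE.
by rewrite (diff_diff (complexP Q)) subr0.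
Qed.

Section Trivial.
Variables (V1 V2 : lmodType k) (b : int).

Notation V := (V1 * V2)%type.

Definition triv_comp_fun (i : int) (x : V) : V :=
  (if i == b then x.1 else 0, if i == b + 1 then x.2 else 0).
Fact triv_comp_linear i : linear (triv_comp_fun i).
Proof.
move=> a x y; rewrite /triv_comp_fun.
rewrite [RHS](_ : _ = (a *: (if i == b then x.1 else 0) + (if i == b then y.1 else 0),
  a *: (if i == b + 1 then x.2 else 0) + (if i == b + 1 then y.2 else 0))) //.
by case: eqP => _; case: eqP => _; rewrite ?scaler0 ?addr0.
Qed.
HB.instance Definition _ i :=
  GRing.isLinear.Build k V V *:%R (triv_comp_fun i) (triv_comp_linear i).
Definition triv_comp i : {linear V -> V} := triv_comp_fun i.

Definition triv_diff (x : V) : V := 0.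
Fact triv_diff_linear : linear triv_diff.
Proof. by move=> a x y; rewrite /triv_diff scaler0 addr0. Qed.
HB.instance Definition _ := GRing.isLinear.Build k V V *:%R triv_diff triv_diff_linear.

Fact succ_neq : (b + 1 == b) = false.
Proof. by rewrite -[X in _ == X]addr0 (inj_eq (addrI _)). Qed.

Fact triv_is_complex : is_complex triv_comp triv_diff.
Proof.
split=> [i j [x y]|[x y]|i [x y]|x] //=.
- rewrite /triv_comp_fun /=; case: (i =P j) => [->|ij].
    by case: (j == b); case: (j == b + 1).
  congr (_, _); first by case: (i =P b) => // ib; case: (j =P b) => // jb; case: ij; rewrite ib.
  by case: (i =P b + 1) => // ib; case: (j =P b + 1) => // jb; case: ij; rewrite ib.
- exists [:: b; b + 1]; first by rewrite /= mem_seq1 eq_sym succ_neq.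
  rewrite big_cons big_seq1 /= /triv_comp_fun /= !eqxx succ_neq eq_sym succ_neq.
  rewrite [RHS](_ : _ = (x + 0, 0 + y)) //.
  by rewrite addr0 add0r.
- rewrite /triv_diff /triv_comp_fun /=.
  by rewrite !if_same.
Qed.

Definition triv_cx : complex k := Complex triv_is_complex.

Definition triv_lact (r : R) (x : triv_cx) : triv_cx := aug r *: (x : V).

Fact triv_linl (x : triv_cx) : linear (triv_lact^~ x).
Proof. by move=> a r s; rewrite /triv_lact (aug_linear R_conn) scalerDl scalerA. Qed.
Fact triv_linr r : linear (triv_lact r).
Proof. by move=> a x y; rewrite /triv_lact scalerDr !scalerA mulrC. Qed.
Fact triv_lact1 x : triv_lact 1 x = x.
Proof. by rewrite /triv_lact aug1 // scale1r. Qed.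
Fact triv_lactM r s x : triv_lact (r * s) x = triv_lact r (triv_lact s x).
Proof. by rewrite /triv_lact (augM R_conn) scalerA. Qed.
Fact triv_homog i j (r : dga_cx R) (x : triv_cx) :
  homog i r -> homog j x -> homog (i + j) (triv_lact r x).
Proof.
move=> hr hx; have [i0|i0] := eqVneq i 0.
  by rewrite i0 add0r /homog linearZ_LR hx.
by rewrite /triv_lact (aug_homog R_conn hr i0) scale0r; apply: homog0.
Qed.
Fact triv_leibniz i (r : dga_cx R) (x : triv_cx) : homog i r ->
  diff (triv_lact r x) = triv_lact (diff r) x + sgn k i *: triv_lact r (diff x).
Proof.
by move=> _; rewrite /triv_lact (aug_diff R_conn) scale0r /= /triv_diff !scaler0 addr0.
Qed.

(** The vector spaces V1 and V2 in the degrees b and b + 1, with zero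
    differential and with R acting through its augmentation. *)
Definition triv : dglmod R := DGLMod triv_linl triv_linr triv_lact1 triv_lactM
  triv_homog triv_leibniz.

End Trivial.

Hypothesis R_deg1 : forall r : dga_cx R, homog 1 r -> r = 0.

(** A module with cohomology in two adjacent degrees only is quasi-isomorphic to
    that cohomology. Indeed R^1 = 0, so nothing from degree b reaches degree b + 1
    under the augmentation ideal, and taking cohomology classes in the two lowest
    degrees of a truncated module is R-linear. *)
Lemma two_degree_formal (Y : dglmod R) (b : int) :
  (forall j, j != b -> j != b + 1 -> Hvanish Y j) ->
  exists (T : dglmod R) (i : dgl_map T Y)
    (p : dgl_map T (triv 'H^b(Y) 'H^(b + 1)(Y) b)),
    [/\ forall j, Hinj i j, forall j, Hsurj i j,
        forall j, Hinj p j & forall j, Hsurj p j].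
Proof.
move=> Y0; have [T [i [Tlow ii is_]]] := truncation Y b.
have {}is_ j : Hsurj i j.
  have [jb|] := ltP j b; last exact: is_.
  move=> y hy dy; have [||z yz] := Y0 j _ _ y hy dy.
  - by rewrite lt_eqF.
  - by rewrite lt_eqF // (lt_trans jb) // ltzD1.
  exists 0, z; rewrite !linear0 add0r; split=> //; exact: homog0.
have T0 j : j != b -> j != b + 1 -> Hvanish T j.
  move=> jb jb1 x hx dx; apply: (ii j) => //; apply: (Y0 j) => //.
    by rewrite /homog -cm_comp hx.
  by rewrite -cm_diff dx linear0.
have [c1 [c1E c1c]] := class_map Y b.
have [c2 [c2E c2c]] := class_map Y (b + 1).
have bd j (c : {linear Y -> 'H^j(Y)}) :
    (forall z : cocycle Y j, c (val z) = lpi (@boundary_closed k Y j) z) ->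
    (forall x, c (comp j x) = c x) -> forall x, c (diff x) = 0.
  move=> cE cc x; rewrite -cc comp_diffE.
  have zc : diff (comp (j - 1) x) \in @cocycle_pred k Y j.
    apply/cocycleP; split; last exact: (diff_diff (complexP Y)).
    by rewrite -[X in homog X](subrK 1); apply/diff_homog/comp_homog.
  rewrite -[diff _]/(val (Cocycle zc)) cE; apply/lpi_boundary.
  by exists (comp (j - 1) x).
have [||||p pE] := @dgl_map_ex k R T (triv 'H^b(Y) 'H^(b + 1)(Y) b)
  (fun x => (c1 (i x), c2 (i x))).
- by move=> a x y; rewrite !linearP.
- move=> j x; rewrite /= /triv_comp_fun /= cm_comp; congr (_, _).
    have [->|jb] := eqVneq j b; first exact: c1c.
    by rewrite -c1c (comp_comp (complexP Y)) eq_sym (negPf jb) linear0.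
  have [->|jb] := eqVneq j (b + 1); first exact: c2c.
  by rewrite -c2c (comp_comp (complexP Y)) eq_sym (negPf jb) linear0.
- by move=> x; rewrite cm_diff (bd _ _ c1E c1c) (bd _ _ c2E c2c).
- move=> r x; elim/(@homog_ind k (dga_cx R)): r => [|r s IHr IHs|l r hr].
  + by rewrite !lact0l !linear0.
  + by rewrite !lactDl !linearD -IHr -IHs.
  have [l0|l0|l0] := ltgtP l 0.
  + by rewrite (conn_neg R_conn l0 hr) !lact0l !linear0.
  + have [l1|l1] := eqVneq l 1.
      by rewrite l1 in hr; rewrite (R_deg1 hr) !lact0l !linear0.
    rewrite /= /triv_lact (aug_homog R_conn hr) ?gt_eqF // scale0r -c1c -c2c.
    have l2 : 1 < l by rewrite lt_neqAle eq_sym l1 -gtz0_ge1.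
    rewrite -!cm_comp !(lact_comp _ _ hr).
    rewrite (Tlow _ _ _ (comp_homog (b - l) x)) ?ltrBlDr ?ltrDl //.
    rewrite (Tlow _ _ _ (comp_homog (b + 1 - l) x)) ?ltrBlDr ?ltrD2l //.
    by rewrite lact0r !linear0.
  rewrite l0 in hr; rewrite !(lact_deg0 _ hr) !linearZ_LR.
  by [].
have cls j (c : {linear Y -> 'H^j(Y)}) :
    (forall z : cocycle Y j, c (val z) = lpi (@boundary_closed k Y j) z) ->
    forall x : T, homog j x -> diff x = 0 -> c (i x) = 0 -> exists y, x = diff y.
  move=> cE x hx dx cx; have zc : i x \in @cocycle_pred k Y j.
    by apply/cocycleP; rewrite /homog -cm_comp -cm_diff hx dx linear0.
  apply: (ii j) => //; apply/(lpi_boundary (Cocycle zc)).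
  by rewrite -cE.
have sur j (c : {linear Y -> 'H^j(Y)}) :
    (forall z : cocycle Y j, c (val z) = lpi (@boundary_closed k Y j) z) ->
    (forall x, c (comp j x) = c x) ->
    forall h, exists x : T, [/\ homog j x, diff x = 0 & c (i x) = h].
  move=> cE cc h; have := cE (lrepr h); rewrite lreprK.
  case: (lrepr h) => y /= yc; have /cocycleP[hy dy] := yc => <-.
  have [x [z [hx dx ->]]] := is_ j y hy dy; exists x; split=> //.
  by rewrite linearD (bd _ _ cE cc) addr0.
exists T, i, p; split=> // j.
- move=> x hx dx [y]; rewrite pE => -[cx1 cx2].
  have [jb|jb] := eqVneq j b; first by rewrite jb in hx; apply: cls cx1.
  have [jb1|jb1] := eqVneq j (b + 1); first by rewrite jb1 in hx; apply: cls cx2.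
  exact: (T0 j).
move=> [h1 h2] hy _; move: hy; rewrite /homog /= /triv_comp_fun /=.
have [->|jb] := eqVneq j b.
  rewrite [b == _]eq_sym succ_neq => -[<-].
  have [x [hx dx cx]] := sur _ _ c1E c1c h1.
  exists x, 0; split=> //; rewrite pE /= /triv_diff addr0 cx.
  have ixE : i x = comp b (i x) by rewrite -cm_comp hx.
  by rewrite -c2c ixE (comp_comp (complexP Y)) succ_neq linear0.
have [->|jb1] := eqVneq j (b + 1).
  move=> [<-]; have [x [hx dx cx]] := sur _ _ c2E c2c h2.
  exists x, 0; split=> //; rewrite pE /= /triv_diff addr0 cx.
  have ixE : i x = comp (b + 1) (i x) by rewrite -cm_comp hx.
  by rewrite -c1c ixE (comp_comp (complexP Y)) eq_sym succ_neq linear0.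
move=> [<- <-]; exists 0, 0; rewrite !linear0 addr0; split=> //; exact: homog0.
Qed.

End Connected.

(** * Balanced pairings *)

Section Functionals.
Variables (k : fieldType) (X : complex k) (n : int).

(** A functional of degree -n killing the coboundaries kills the cocycles of
    degree n as well if these are coboundaries, and then it factors through the
    differential. *)
Lemma functional_exact (V : lmodType k) (f : {linear X -> V}) :
  Hvanish X n -> (forall u, f (comp n u) = f u) -> (forall u, f (diff u) = 0) ->
  exists2 g : {linear X -> V},
    forall u, g (comp (n + 1) u) = g u & forall u, f u = g (diff u).
Proof.
move=> H0 fn fd; have [|g gE] := @linear_factor k X X V diff f.
  move=> u du; rewrite -fn; have [||v ->] := H0 (comp n u); last exact: fd.
    exact: comp_homog.
  by rewrite (comp_diff (complexP X)) du linear0.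
have gn_lin : linear (fun u => g (comp (n + 1) u)).
  by move=> a u v; rewrite !linearP.
exists (mk_linear gn_lin) => u /=; first by rewrite (comp_comp (complexP X)) eqxx.
by rewrite -(comp_diff (complexP X)) gE fn.
Qed.

Lemma functional_nonexact : ~ Hvanish X n ->
  exists f : {linear X -> k^o},
    [/\ forall u, f (comp n u) = f u, forall u, f (diff u) = 0
      & forall g : {linear X -> k^o}, ~ (forall u, f u = g (diff u))].
Proof.
move=> nH; have [z [hz dz nz]] : exists z : X,
    [/\ homog n z, diff z = 0 & ~ exists y, z = diff y].
  apply: contrapT => nz; apply: nH => z hz dz; apply: contrapT => nb.
  by apply: nz; exists z.
pose S : {pred X} := fun u => `[< exists v, u = diff v >].
have [||l l0 l1] := @separating_functional k X S z.
- split=> [|a u v /asboolP[u' ->] /asboolP[v' ->]]; apply/asboolP.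
    by exists 0; rewrite linear0.
  by exists (a *: u' + v'); rewrite linearP.
- by apply/asboolP.
have ln_lin : linear (fun u => l (comp n u)) by move=> a u v; rewrite !linearP.
exists (mk_linear ln_lin); split=> [u|u|g /(_ z)] /=.
- by rewrite (comp_comp (complexP X)) eqxx.
- by apply: l0; apply/asboolP; rewrite comp_diffE; exists (comp (n - 1) u).
by rewrite hz l1 dz linear0; apply/eqP/oner_neq0.
Qed.

End Functionals.

Section Pairing.
Variables (k : fieldType) (R : dga k) (P : dgrmod R) (F : dglmod R).

(** A linear map of degree -n out of the tensor product, given on pure tensors. *)
Record pairing (V : lmodType k) (n : int) (phi : P -> F -> V) : Prop := Pairing {
  pair_linl : forall x, linear (phi^~ x);
  pair_linr : forall p, linear (phi p);
  pair_bal : forall p r x, phi (ract p r) x = phi p (lact r x);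
  pair_deg : forall i j p x, homog i p -> homog j x -> i + j != n -> phi p x = 0
}.

(** The composite of psi with the differential of the tensor product, on elements
    p of degree i. *)
Definition pair_diff (V : lmodType k) (psi : P -> F -> V) (i : int) (p : P) (x : F) : V :=
  psi (diff p) x + sgn k i *: psi p (diff x).

Lemma tens_ext (V : lmodType k) (f g : {linear tensor P F -> V}) :
  (forall i j p x, homog i p -> homog j x -> f (tens p x) = g (tens p x)) -> f =1 g.
Proof.
move=> fg; elim/tens_homog_ind => [|u v IHu IHv|i j p x hp hx].
- exact: etrans (linear0 f) (esym (linear0 g)).
- by apply: etrans (linearD f u v) _; rewrite IHu IHv; apply: esym (linearD g u v).
- exact: fg hp hx.
Qed.

Lemma comp_tens n i j p x : homog i p -> homog j x ->
  comp n (tens p x : tensor P F) = if n == i + j then tens p x else 0.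
Proof. exact: tensor_comp_homog. Qed.

Lemma diff_tens i p x : homog i p ->
  diff (tens p x : tensor P F) = tens (diff p) x + sgn k i *: tens p (diff x).
Proof. exact: tensor_diff_homog. Qed.

Lemma pair_lift (V : lmodType k) n (phi : P -> F -> V) : pairing n phi ->
  exists Phi : {linear tensor P F -> V},
    (forall p x, Phi (tens p x) = phi p x) /\ (forall u, Phi (comp n u) = Phi u).
Proof.
move=> [pl pr pb pd]; pose Phi : {linear tensor P F -> V} := mk_linear (tens_lift_linear pl pr pb).
have PhiE p x : Phi (tens p x) = phi p x by apply: tens_liftE.
exists Phi; split=> // u.
pose L : {linear tensor P F -> V} := Phi \o comp n.
rewrite -[LHS]/(L u); apply: tens_ext u => i j p x hp hx.
rewrite [LHS](_ : _ = Phi (comp n (tens p x : tensor P F))) // (comp_tens n hp hx).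
rewrite eq_sym; case: eqP => // /eqP ijn.
by rewrite PhiE (pd _ _ _ _ hp hx) //; apply: linear0.
Qed.

Lemma pair_lift_diff (V : lmodType k) (phi psi : P -> F -> V)
    (Phi Psi : {linear tensor P F -> V}) :
  (forall p x, Phi (tens p x) = phi p x) -> (forall p x, Psi (tens p x) = psi p x) ->
  (forall i p x, homog i p -> phi p x = pair_diff psi i p x) <->
  (forall u, Phi u = Psi (diff u)).
Proof.
move=> PhiE PsiE; have PsidE i p x : homog i p ->
    Psi (diff (tens p x : tensor P F)) = pair_diff psi i p x.
  move=> hp; rewrite (diff_tens _ hp); apply: etrans (linearD Psi _ _) _.
  rewrite PsiE /pair_diff; congr (_ + _).
  by apply: etrans (linearZ_LR Psi _ _) _; rewrite PsiE.
split=> [h u|h i p x hp]; last by rewrite -PsidE // -PhiE.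
pose L : {linear tensor P F -> V} := Psi \o diff.
rewrite -[RHS]/(L u); apply: tens_ext u => i j p x hp hx.
rewrite [RHS](_ : _ = Psi (diff (tens p x : tensor P F))) //.
by rewrite PhiE (h _ _ _ hp) -PsidE.
Qed.

Lemma tens_pairing (V : lmodType k) n (L : {linear tensor P F -> V}) :
  (forall u, L (comp n u) = L u) -> pairing n (fun p x => L (tens p x)).
Proof.
move=> Ln; split=> [x a p q|p a x y|p r x|i j p x hp hx ijn].
- exact: etrans (congr1 L (tens_linl x a p q)) (linearP L a _ _).
- exact: etrans (congr1 L (tens_linr p a x y)) (linearP L a _ _).
- by rewrite tens_bal.
- by rewrite -Ln (comp_tens _ hp hx) eq_sym (negPf ijn); apply: linear0.
Qed.

Lemma pair_closed (V : lmodType k) (phi : P -> F -> V) (Phi : {linear tensor P F -> V}) :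
  (forall p x, Phi (tens p x) = phi p x) ->
  (forall i p x, homog i p -> pair_diff phi i p x = 0) <-> (forall u, Phi (diff u) = 0).
Proof.
move=> PhiE; have h := @pair_lift_diff V (fun _ _ => 0) phi \0 Phi (fun _ _ => erefl) PhiE.
split=> [phi0 u|Phi0 i p x hp]; last by rewrite -h.2 // => u; rewrite Phi0.
by rewrite -h.1 // => i p x hp; rewrite phi0.
Qed.

Lemma pairing_exact (V : lmodType k) n (phi : P -> F -> V) :
  Hvanish (tensor P F) n -> pairing n phi ->
  (forall i p x, homog i p -> pair_diff phi i p x = 0) ->
  exists2 psi : P -> F -> V, pairing (n + 1) psi
    & forall i p x, homog i p -> phi p x = pair_diff psi i p x.
Proof.
move=> H0 phi_pair phi_closed; have [Phi [PhiE Phin]] := pair_lift phi_pair.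
have [Psi Psin PhiPsi] := functional_exact H0 Phin ((pair_closed PhiE).1 phi_closed).
exists (fun p x => Psi (tens p x)); first exact: tens_pairing.
exact: (pair_lift_diff PhiE (fun _ _ => erefl)).2 PhiPsi.
Qed.

Lemma pairing_nonexact n : ~ Hvanish (tensor P F) n ->
  exists phi : P -> F -> k^o,
    [/\ pairing n phi,
        forall i p x, homog i p -> pair_diff phi i p x = 0
      & forall psi m, pairing m psi ->
        ~ (forall i p x, homog i p -> phi p x = pair_diff psi i p x)].
Proof.
move=> /functional_nonexact[Phi [Phin Phid nPhi]].
exists (fun p x => Phi (tens p x)); split=> [|i p x hp|psi m psi_pair phiE].
- exact: tens_pairing.
- exact: (pair_closed (Phi := Phi) (fun _ _ => erefl)).2 Phid i p x hp.
have [Psi [PsiE _]] := pair_lift psi_pair; apply: (nPhi Psi).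
exact: (pair_lift_diff (fun _ _ => erefl) PsiE).1 phiE.
Qed.

End Pairing.

(** * Betti numbers as obstructions *)

Section Betti.
Variables (k : fieldType) (R : dga k) (R_conn : connected R) (F : dglmod R).

Notation K := (kmod R_conn).
Notation one := ((1 : k^o) : K).

Lemma pair_comp (P : dgrmod R) (V : lmodType k) n (phi : P -> F -> V) i p j x :
  pairing n phi -> homog i p ->
  phi p (comp j x) = if i + j == n then phi p x else 0.
Proof.
move=> phi_pair hp; pose f := mk_linear (pair_linr phi_pair p).
rewrite -[phi p _]/(f _) -[phi p x]/(f x).
elim/homog_ind: x => [|x y IHx IHy|m x hx]; first by rewrite !linear0 if_same.
  by rewrite !linearD IHx IHy; case: eqP; rewrite ?addr0.
rewrite (comp_homogE _ hx); case: (j =P m) => [->|jm].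
  by case: eqP => // /eqP/(pair_deg phi_pair hp hx).
rewrite linear0; case: eqP => // ijn; rewrite /= (pair_deg phi_pair hp hx) //.
by apply/eqP => imn; apply: jm; apply: (addrI i); rewrite ijn imn.
Qed.

Lemma k_homog0 (c : K) : homog 0 c.
Proof. by []. Qed.

Lemma k_homog_neq0 i (c : K) : homog i c -> i != 0 -> c = 0.
Proof. by move=> <- i0; rewrite /= /k_comp (negPf i0). Qed.

Lemma aug_twist r : aug (twist (r : dga_cx R) : R) = aug r.
Proof.
elim/(@homog_ind k (dga_cx R)): r => [|r s IHr IHs|i r hr].
- by rewrite twist0 aug0.
- by rewrite twistD !augD // IHr IHs.
rewrite (twistE hr); have [->|i0] := eqVneq i 0.
  by rewrite [sgn k 0]expr0z scale1r.
rewrite (aug_homog R_conn hr i0) (aug_homog R_conn (i := i)) //.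
by rewrite /homog linearZ_LR hr.
Qed.

(** A map u from F to a vector space in degree b is the pairing c, x |-> c u(x),
    and a null homotopy of u is a pairing that bounds it. *)
Lemma null_of_betti (V1 V2 : lmodType k) (b : int) (u : dgl_map F (triv R_conn V1 V2 b)) :
  Hvanish (tensor K F) b -> trivial_space V2 -> null_homotopic u.
Proof.
move=> H0 V20; pose phi (c : K) x : V1 := (c : k) *: (u x).1.
have phi_pair : pairing b phi.
  split=> [x a c d|c a x y|c r x|i j c x hc hx ij].
  - by rewrite /phi scalerDl scalerA.
  - by rewrite /phi linearP /= scalerDr !scalerA mulrC.
  - by rewrite /phi dglm_lact /= scalerA.
  have [i0|/(k_homog_neq0 hc) ->] := eqVneq i 0; last by rewrite /phi scale0r.
  have : homog j (u x) by rewrite /homog -cm_comp hx.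
  rewrite /homog /= /triv_comp_fun => /(congr1 fst) /=; rewrite /phi.
  have [jb|_ <-] := eqVneq j b; last by rewrite scaler0.
  by move: ij; rewrite i0 add0r jb eqxx.
have [|psi psi_pair psiE] := pairing_exact H0 phi_pair.
  move=> i c x _; rewrite /pair_diff /phi cm_diff /= scale0r !scaler0.
  exact: addr0.
have uE x : (u x).1 = psi one (diff x).
  have := psiE 0 one x (k_homog0 _); rewrite /phi /pair_diff scale1r => ->.
  rewrite [sgn k 0]expr0z scale1r.
  have /= := linear0 (mk_linear (pair_linl psi_pair x)).
  by rewrite -[diff (one : K)]/(0 : K) => ->; rewrite add0r.
have h_lin : linear (fun x => (psi one x, 0) : triv R_conn V1 V2 b).
  move=> a x y; rewrite (pair_linr psi_pair).
  rewrite [RHS](_ : _ = (a *: psi one x + psi one y, a *: (0 : V2) + 0)) //.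
  by rewrite scaler0 addr0.
exists (mk_linear h_lin); split=> [i x hx|i r x hr|x].
- rewrite /homog /= /triv_comp_fun /= if_same; congr (_, _).
  case: eqP => // /eqP ib; rewrite (pair_deg psi_pair (k_homog0 _) hx) //.
  by rewrite add0r -subr_eq.
- rewrite /= /triv_lact -(pair_bal psi_pair).
  rewrite [RHS](_ : _ = (sgn k i *: (aug r *: psi one x), sgn k i *: (aug r *: (0 : V2)))) //.
  rewrite !scaler0; congr (_, _).
  have -> : ract one r = aug r *: one :> K by rewrite /= /k_ract mul1r [RHS]mulr1.
  have /= -> := linearZ_LR (mk_linear (pair_linl psi_pair x)) (aug r) one.
  have [->|i0] := eqVneq i 0; first by rewrite [sgn k 0]expr0z scale1r.
  by rewrite (aug_homog R_conn hr i0) !scale0r scaler0.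
- rewrite /= /triv_diff add0r [LHS]surjective_pairing uE.
  by congr (_, _); apply: V20.
Qed.

(** A nonzero class of k (x) F gives a functional, hence a map to the line of z. *)
Lemma nonnull_of_betti (V1 V2 : lmodType k) (b : int) (z : V2) : z != 0 ->
  ~ Hvanish (tensor K F) (b + 1) ->
  exists u : dgl_map F (triv R_conn V1 V2 b), ~ null_homotopic u.
Proof.
move=> z0 /pairing_nonexact[phi [phi_pair phi_closed phi_nonexact]].
have phiZ c x : phi c x = (c : k) * (phi one x : k).
  have /= := linearZ_LR (mk_linear (pair_linl phi_pair x)) (c : k) one.
  by rewrite -[c *: one]/(c * 1) mulr1.
have phi0 x : phi 0 x = 0 by rewrite phiZ mul0r.
have [||||u uE] := @dgl_map_ex k R F (triv R_conn V1 V2 b) (fun x => (0, phi one x *: z)).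
- move=> a x y; rewrite (pair_linr phi_pair).
  rewrite [RHS](_ : _ = (a *: (0 : V1) + 0, a *: (phi one x *: z) + phi one y *: z)) //.
  by rewrite scaler0 addr0 scalerDl scalerA.
- move=> j x; rewrite (pair_comp _ _ phi_pair (k_homog0 _)) add0r.
  rewrite /= /triv_comp_fun /= if_same; case: eqP => // _.
  by rewrite scale0r.
- move=> x; have := phi_closed 0 one x (k_homog0 _).
  rewrite /pair_diff -[diff (one : K)]/(0 : K) phi0 [sgn k 0]expr0z scale1r add0r => ->.
  by rewrite scale0r.
- move=> r x; rewrite -(pair_bal phi_pair) phiZ /= /triv_lact.
  rewrite [RHS](_ : _ = (aug r *: (0 : V1), aug r *: (phi one x *: z))) //.
  by rewrite scaler0 scalerA /k_ract mul1r.
exists u => -[h [h_homog h_lact hE]].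
have [||l _ lz] := @separating_functional k V2 (pred1 0) z.
- split=> [|a x y /eqP-> /eqP->]; rewrite inE //.
  by rewrite scaler0 addr0.
- by rewrite inE.
pose psi (c : K) x : k^o := (c : k) * (l (h x).2 : k).
apply: (phi_nonexact psi (b + 2)).
  split=> [x a c d|c a x y|c r x|i j c x hc hx ij].
  - by rewrite /psi mulrDl -mulrA.
  - by rewrite /psi !linearP mulrDr mulrCA.
  - rewrite /psi (homotopy_lact h_lact) /= /triv_lact /=.
    rewrite [X in _ = _ * X](linearZ_LR l) [RHS]mulrA.
    by congr (_ * _); rewrite aug_twist.
  have [i0|/(k_homog_neq0 hc) ->] := eqVneq i 0; last by rewrite /psi mul0r.
  have := h_homog _ _ hx; rewrite /homog /= /triv_comp_fun => /(congr1 snd) /=.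
  rewrite /psi subr_eq -addrA; have [jb|_ <-] := eqVneq j (b + 2).
    by move: ij; rewrite i0 add0r jb eqxx.
  by rewrite linear0 mulr0.
move=> i c x hc; rewrite phiZ /pair_diff /psi /= /k_diff mul0r add0r.
have [i0|/(k_homog_neq0 hc) ->] := eqVneq i 0; last by rewrite !mul0r scaler0.
rewrite i0 [sgn k 0]expr0z scale1r; congr (_ * _).
have := hE x; rewrite uE /= /triv_diff add0r => <- /=.
by rewrite linearZ_LR lz [RHS]mulr1.
Qed.

End Betti.

(** * The dual of a right module *)

Section Dual.
Variables (k : fieldType) (R : dga k) (P : dgrmod R) (n : int).

Notation Pd := (P -> k^o).

(** The functionals supported in finitely many degrees: being a direct sum, a
    graded space has no room for the others. *)
Definition dual_pred : {pred Pd} := fun f => `[< linear f /\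
  exists s : seq int, forall i p, i \notin s -> homog i p -> f p = 0 >].

Fact dual_closed : submod_closed dual_pred.
Proof.
split=> [|a f g /asboolP[fl [s fs]] /asboolP[gl [t gt]]]; apply/asboolP.
  split; last by exists [::].
  by move=> a p q; rewrite [RHS]addr0 [RHS]scaler0.
split; last first.
  exists (s ++ t) => i p; rewrite mem_cat negb_or => /andP[si ti] hp.
  by rewrite -[LHS]/(a *: f p + g p) (fs i) // (gt i) // scaler0 addr0.
move=> c p q; rewrite -![(a *: f + g) _]/(a *: f _ + g _) fl gl !scalerDr.
by rewrite !scalerA mulrC addrACA.
Qed.

Record dual_car := DualCar { dual_fun : Pd; _ : dual_fun \in submod_pred dual_closed }.
HB.instance Definition _ := [isSub for dual_fun].
HB.instance Definition _ := [Choice of dual_car by <:].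
HB.instance Definition _ := [SubChoice_isSubLmodule of dual_car by <:].

Lemma dual_linear (f : dual_car) : linear (val f).
Proof. by case: f => f /= /asboolP[]. Qed.

Lemma dual_supp (f : dual_car) :
  exists s : seq int, forall i p, i \notin s -> homog i p -> val f p = 0.
Proof. by case: f => f /= /asboolP[]. Qed.

Lemma dual_ext (f g : dual_car) : val f =1 val g -> f = g.
Proof. by move=> fg; apply: val_inj; apply: funext. Qed.

Lemma dual0 (f : dual_car) : val f 0 = 0.
Proof. exact: (linear0 (mk_linear (dual_linear f))). Qed.
Lemma dualD (f : dual_car) p q : val f (p + q) = val f p + val f q.
Proof. exact: (linearD (mk_linear (dual_linear f))). Qed.
Lemma dualZ (f : dual_car) a p : val f (a *: p) = a *: val f p.
Proof. exact: (linearZ_LR (mk_linear (dual_linear f))). Qed.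
Lemma dualN (f : dual_car) p : val f (- p) = - val f p.
Proof. exact: (linearN (mk_linear (dual_linear f))). Qed.

Lemma dual_in (f : Pd) : linear f ->
  (exists s : seq int, forall i p, i \notin s -> homog i p -> f p = 0) ->
  f \in submod_pred dual_closed.
Proof. by move=> fl fs; apply/asboolP. Qed.

Fact dual_comp_subproof i (f : dual_car) :
  (fun p => val f (comp (n - i) p)) \in submod_pred dual_closed.
Proof.
apply: dual_in => [a p q|]; first by rewrite linearP dual_linear.
exists [:: n - i] => j p; rewrite mem_seq1 => ji hp.
by rewrite (comp_homogE _ hp) eq_sym (negPf ji) dual0.
Qed.
Definition dual_comp_fun i (f : dual_car) : dual_car := DualCar (dual_comp_subproof i f).
Fact dual_comp_linear i : linear (dual_comp_fun i).
Proof. by move=> a f g; apply: dual_ext => p. Qed.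
HB.instance Definition _ i := GRing.isLinear.Build k dual_car dual_car *:%R
  (dual_comp_fun i) (dual_comp_linear i).
Definition dual_comp i : {linear dual_car -> dual_car} := dual_comp_fun i.

(* The sign (-1)^(|p| + 1) is the one for which f |-> (p |-> f (p r)), taken
   without sign, satisfies the Leibniz rule. *)
Fact dual_diff_subproof (f : dual_car) :
  (fun p => val f (twist (diff p))) \in submod_pred dual_closed.
Proof.
apply: dual_in => [a p q|]; first by rewrite !linearP dual_linear.
have [s fs] := dual_supp f; exists [seq i - 1 | i <- s] => j p js hp.
apply: (fs (j + 1)); last exact/homog_twist/diff_homog.
by apply: contra js => js; apply/mapP; exists (j + 1); rewrite ?addrK.
Qed.
Definition dual_diff (f : dual_car) : dual_car := DualCar (dual_diff_subproof f).
Fact dual_diff_linear : linear dual_diff.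
Proof. by move=> a f g; apply: dual_ext => p. Qed.
HB.instance Definition _ := GRing.isLinear.Build k dual_car dual_car *:%R
  dual_diff dual_diff_linear.

Lemma val_sum (s : seq int) (G : int -> dual_car) p :
  val (\sum_(i <- s) G i) p = \sum_(i <- s) val (G i) p.
Proof.
elim: s => [|i s IH]; first by rewrite !big_nil.
by rewrite !big_cons -IH.
Qed.

Lemma twist_diff_twist (X : complex k) (x : X) : twist (diff (twist x)) = - diff x.
Proof. by rewrite diff_twist -scaleN1r twistZ twistK scaleN1r. Qed.

Fact dual_is_complex : is_complex dual_comp dual_diff.
Proof.
split=> [i j f|f|i f|f].
- apply: dual_ext => p /=; rewrite (comp_comp (complexP P)).
  rewrite (inj_eq (addrI _)) (inj_eq oppr_inj) eq_sym.
  by case: eqP => [->|] //; rewrite dual0.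
- have [s fs] := dual_supp f; exists [seq n - i | i <- undup s].
    rewrite map_inj_uniq ?undup_uniq // => i j /addrI.
    exact: oppr_inj.
  apply: dual_ext => p; rewrite val_sum big_map.
  under eq_bigr => i _ do rewrite /= subKr.
  elim/homog_ind: p => [|p q IHp IHq|i p hp].
  + by rewrite dual0 big1 // => i _; rewrite linear0 dual0.
  + rewrite dualD IHp IHq -big_split; apply: eq_bigr => i _.
    by rewrite linearD dualD.
  have [si|si] := boolP (i \in undup s); last first.
    have fp : val f p = 0 by apply: fs hp; rewrite -mem_undup.
    rewrite fp big1_seq // => j /andP[_ js].
    rewrite (comp_homogE _ hp); case: eqP => [ji|_]; last exact: dual0.
    by rewrite -ji js in si.
  rewrite (bigD1_seq i) ?undup_uniq //= hp big1 ?addr0 // => j ji.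
  by rewrite (comp_homogE _ hp) (negPf ji) dual0.
- apply: dual_ext => p /=; rewrite comp_twist (comp_diff (complexP P)).
  by congr (val f (twist (comp _ _))); rewrite opprD addrA subrK.
- apply: dual_ext => p /=.
  by rewrite diff_twist (diff_diff (complexP P)) twist0 oppr0 twist0 dual0.
Qed.

Definition dual_cx : complex k := Complex dual_is_complex.

Fact dual_lact_subproof (r : R) (f : dual_car) :
  (fun p => val f (ract p r)) \in submod_pred dual_closed.
Proof.
apply: dual_in => [a p q|]; first by rewrite ract_linl dual_linear.
elim/(@homog_ind k (dga_cx R)): r => [|r s [u ru] [v sv]|l r hr].
- by exists [::] => i p _ _; rewrite ract0r dual0.
- exists (u ++ v) => i p; rewrite mem_cat negb_or => /andP[iu iv] hp.
  by rewrite ractDr dualD (ru i) // (sv i) // addr0.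
have [s fs] := dual_supp f; exists [seq i - l | i <- s] => i p is_ hp.
apply: (fs (i + l)); last exact: (ract_homog hp hr).
by apply: contra is_ => is_; apply/mapP; exists (i + l); rewrite ?addrK.
Qed.
Definition dual_lact (r : R) (f : dual_cx) : dual_cx := DualCar (dual_lact_subproof r f).

Fact dual_linl (f : dual_cx) : linear (dual_lact^~ f).
Proof.
by move=> a r s; apply: dual_ext => p; rewrite /= ract_linr dual_linear.
Qed.
Fact dual_linr r : linear (dual_lact r).
Proof. by move=> a f g; apply: dual_ext => p. Qed.
Fact dual_lact1 f : dual_lact 1 f = f.
Proof. by apply: dual_ext => p; rewrite /= ract1. Qed.
Fact dual_lactM r s f : dual_lact (r * s) f = dual_lact r (dual_lact s f).
Proof. by apply: dual_ext => p; rewrite /= ractM. Qed.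

Lemma homog_dual i (f : dual_cx) : homog i f <->
  forall j p, j != n - i -> homog j p -> val f p = 0.
Proof.
split=> [hf j p ji hp|h].
  by rewrite -hf /= (comp_homogE _ hp) eq_sym (negPf ji) dual0.
apply: dual_ext; elim/homog_ind => [|p q IHp IHq|j p hp].
- by rewrite !dual0.
- by rewrite !dualD IHp IHq.
rewrite /= (comp_homogE _ hp); case: eqP => // /eqP ji.
by rewrite dual0 (h j) // eq_sym.
Qed.

Fact dual_homog i j (r : dga_cx R) (f : dual_cx) :
  homog i r -> homog j f -> homog (i + j) (dual_lact r f).
Proof.
move=> hr /homog_dual hf; apply/homog_dual => m p mij hp /=.
apply: (hf (m + i)); last exact: (ract_homog hp hr).
apply: contra mij => /eqP mi.
by rewrite [i + j]addrC opprD addrA -mi addrK.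
Qed.
Fact dual_leibniz i (r : dga_cx R) (f : dual_cx) : homog i r ->
  diff (dual_lact r f) = dual_lact (diff r) f + sgn k i *: dual_lact r (diff f).
Proof.
move=> hr; apply: dual_ext; elim/homog_ind => [|p q IHp IHq|j p hp].
- by rewrite !dual0.
- by rewrite !dualD IHp IHq.
rewrite [LHS]/= [RHS](_ : _ = val f (ract p (diff r)) +
  sgn k i *: val f (twist (diff (ract p r)))) //.
rewrite (ract_leibniz _ hp) (twistE (diff_homog hp)) twistD twistZ.
rewrite (twistE (ract_homog (diff_homog hp) hr)).
rewrite (twistE (ract_homog hp (diff_homog hr))).
have -> : ract (sgn k (j + 1) *: diff p) r = sgn k (j + 1) *: ract (diff p) r.
  by have := ract_linl r (sgn k (j + 1)) (diff p) 0; rewrite ract0l !addr0.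
have -> : sgn k (j + 1 + i) = sgn k i * sgn k (j + 1) by rewrite sgnD mulrC.
have -> : sgn k (j + (i + 1)) = - (sgn k j * sgn k i) by rewrite sgnD sgnS mulrN.
rewrite dualD !dualZ scalerDr !scalerA [sgn k i * (_ * sgn k (j + 1))]mulrA sgnK mul1r.
rewrite mulrN [sgn k j * (_ * _)]mulrA sgnK mul1r mulrN sgnK scaleN1r.
by rewrite [RHS]addrCA addrN addr0.
Qed.

(** Hom_k(P, k) with P^i placed in degree n - i. *)
Definition dual : dglmod R := DGLMod dual_linl dual_linr dual_lact1 dual_lactM
  dual_homog dual_leibniz.

Lemma dual_Hvanish j : Hvanish P (n - j) -> Hvanish dual j.
Proof.
move=> H0 f hf df.
pose F := mk_linear (dual_linear f).
have [||g gn fg] := @functional_exact k P (n - j) k^o F H0.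
- by move=> p; exact: (congr1 (fun h : dual => val h p) hf).
- move=> p; rewrite /= -[diff p]opprK -twist_diff_twist dualN.
  have := congr1 (fun h : dual => val h (twist p)) df.
  by rewrite /= => ->; rewrite oppr0.
have y_in : (fun p => g (twist p)) \in submod_pred dual_closed.
  apply: dual_in => [a p q|]; first by rewrite !linearP.
  exists [:: n - j + 1] => i p; rewrite mem_seq1 => ij hp.
  by rewrite -gn comp_twist (comp_homogE _ hp) eq_sym (negPf ij) !linear0.
exists (DualCar y_in : dual); apply: dual_ext => p /=.
by rewrite twistK -fg.
Qed.

Lemma dual_nonvanish i : ~ Hvanish P i -> ~ Hvanish dual (n - i).
Proof.
move=> /functional_nonexact[f [fi fd nf]] H0.
have f_in : (f : Pd) \in submod_pred dual_closed.
  apply: dual_in => [|]; first exact: linearP.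
  exists [:: i] => j p; rewrite mem_seq1 => ji hp.
  by rewrite -fi (comp_homogE _ hp) eq_sym (negPf ji) linear0.
have [||y fy] := H0 (DualCar f_in : dual).
- by apply: dual_ext => p; rewrite /= subKr fi.
- apply: dual_ext => p /=; rewrite -[twist _]opprK -diff_twist.
  by rewrite linearN fd oppr0.
have g_lin : linear (fun p => val y (twist p)).
  by move=> a p q; rewrite linearP dual_linear.
apply: (nf (mk_linear g_lin)) => p /=.
by have := congr1 (fun h : dual => val h p) fy.
Qed.

(** Evaluation turns a map from F to the dual into a cocycle pairing; a pairing
    that bounds it is, up to the sign of the grading, a null homotopy. *)
Lemma dual_null (F : dglmod R) (u : dgl_map F dual) :
  Hvanish (tensor P F) n -> null_homotopic u.
Proof.
move=> H0; pose phi p x : k^o := val (u x) p.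
have phi_pair : pairing n phi.
  split=> [x|p a x y|p r x|i j p x hp hx ij].
  - exact: dual_linear.
  - by rewrite /phi linearP.
  - by rewrite /phi dglm_lact.
  have /homog_dual hux : homog j (u x) by rewrite /homog -cm_comp hx.
  apply: hux hp; apply: contra ij => /eqP->.
  by rewrite subrK.
have [|psi psi_pair psiE] := pairing_exact H0 phi_pair.
  move=> i p x hp; rewrite /pair_diff /phi cm_diff /= (twistE (diff_homog hp)).
  by rewrite dualZ scalerA sgnS mulrN sgnK scaleN1r addrN.
have h_in x : (fun p => psi (twist p) x) \in submod_pred dual_closed.
  apply: dual_in => [a p q|].
    by rewrite linearP (pair_linl psi_pair).
  elim/homog_ind: x => [|x y [s hs] [t ht]|j x hx].
  - exists [::] => i p _ _.
    exact: (linear0 (mk_linear (pair_linr psi_pair (twist p)))).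
  - exists (s ++ t) => i p; rewrite mem_cat negb_or => /andP[si ti] hp.
    have /= := linearD (mk_linear (pair_linr psi_pair (twist p))) x y => ->.
    by rewrite (hs i) // (ht i) // addr0.
  exists [:: n + 1 - j] => i p; rewrite mem_seq1 => ij hp.
  by rewrite (pair_deg psi_pair (homog_twist hp) hx) // eq_sym -subr_eq eq_sym.
pose h x : dual := DualCar (h_in x).
have h_lin : linear h.
  by move=> a x y; apply: dual_ext => p; apply: pair_linr psi_pair _ _ _ _.
exists (mk_linear h_lin); split=> [j x hx|j r x hr|x].
- apply/homog_dual => i p ij hp /=; rewrite (pair_deg psi_pair (homog_twist hp) hx) //.
  apply: contra ij => /eqP ij; rewrite opprB addrA -ij.
  by rewrite addrK.
- apply: dual_ext; elim/homog_ind => [|p q IHp IHq|i p hp].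
  + by rewrite !dual0.
  + by rewrite !dualD IHp IHq.
  rewrite [LHS]/= [RHS](_ : _ = sgn k j *: psi (twist (ract p r)) x) //.
  rewrite (twistE hp) (twistE (ract_homog hp hr)).
  have psiZ c q y : psi (c *: q) y = c *: psi q y.
    exact: (linearZ_LR (mk_linear (pair_linl psi_pair y))).
  rewrite !psiZ -(pair_bal psi_pair) scalerA [i + j]addrC sgnD mulrA sgnK mul1r.
  by [].
apply: dual_ext; elim/homog_ind => [|p q IHp IHq|i p hp].
- by rewrite !dual0.
- by rewrite !dualD IHp IHq.
rewrite -[LHS]/(phi p x) (psiE _ _ _ hp) /pair_diff.
rewrite [RHS](_ : _ = psi (twist (twist (diff p))) x + psi (twist p) (diff x)) //.
rewrite twistK (twistE hp); congr (_ + _).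
exact: esym (linearZ_LR (mk_linear (pair_linl psi_pair (diff x))) _ _).
Qed.

End Dual.

(** * Maps into modules of bounded cohomology *)

Section Devissage.
Variables (k : fieldType) (R : dga k) (R_conn : connected R).
Hypothesis R_deg1 : forall r : dga_cx R, homog 1 r -> r = 0.
Variables (F : dglmod R) (F_proj : K_projective F).

Definition betti_zero (l : int) : Prop := Hvanish (tensor (kmod R_conn) F) l.

(** Such a Y is quasi-isomorphic to a vector space in degree b, and the Betti
    number of F in this degree measures the maps to vector spaces. *)
Lemma null_one_degree (Y : dglmod R) (b : int) (w : dgl_map F Y) :
  (forall j, j != b -> Hvanish Y j) -> betti_zero b -> null_homotopic w.
Proof.
move=> Y0 Fb; have [|T [i [p [ii is_ pi ps]]]] := two_degree_formal R_conn R_deg1 (Y := Y) (b := b).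
  by move=> j jb _; apply: Y0.
have [w' ww'] := lift_quasi_iso F_proj w ii is_.
apply: homotopic_null (homotopic_sym ww') _; apply: null_compl.
apply: (null_cancel F_proj pi ps); apply: null_of_betti => //.
by apply/Hvanish_trivial/Y0; rewrite succ_neq.
Qed.

(** Going down from degree N, the truncations of Q gain one cohomology group at
    a time. The fibre of an inclusion between consecutive truncations carries
    this group one degree higher, where the Betti number of F vanishes, so a map
    which is not null homotopic stays so. The process starts in the two degrees
    N - 1 and N, where Q is a mere graded vector space. *)
Lemma nonnull_exists (N : int) (d : nat) (Q : dglmod R) :
  (forall j : int, j < N - 1 - d%:Z -> Hvanish Q j) ->
  (forall j : int, N < j -> Hvanish Q j) ->
  ~ Hvanish Q N ->
  (forall l : int, N - d%:Z <= l -> l < N -> betti_zero l) -> ~ betti_zero N ->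
  exists w : dgl_map F Q, ~ null_homotopic w.
Proof.
elim: d Q => [|d IH] Q Qlow Qhigh QN Flow FN.
  have [|T [i [p [ii is_ pi ps]]]] := two_degree_formal R_conn R_deg1 (Y := Q) (b := N - 1).
    move=> j; rewrite subrK => jN1 jN; have [Nj|Nj] := ltP N j; first exact: Qhigh.
    by apply: Qlow; lia.
  have [z z0] : exists z : 'H^(N - 1 + 1)(Q), z != 0.
    apply: contrapT => nz; apply: QN; apply/Hvanish_trivial; rewrite -(subrK 1 N) => z.
    by apply: contrapT => /eqP z0; apply: nz; exists z.
  have [|u nu] := @nonnull_of_betti k R R_conn F 'H^(N - 1)(Q) _ (N - 1) z z0.
    by rewrite subrK.
  have [w uw] := lift_quasi_iso F_proj u pi ps.
  exists (dgl_comp i w) => iw0; have w0 := null_cancel F_proj ii is_ iw0.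
  by apply: nu; apply: homotopic_null (homotopic_sym uw) _; apply: null_compl.
have [T [i [Tlow ii is_]]] := truncation R_conn Q (N - 1 - d%:Z).
have [|||||w nw] := IH T.
- move=> j jN x hx _; exists 0; rewrite linear0; exact: (Tlow j).
- move=> j Nj x hx dx; apply: (ii j) => //; apply: (Qhigh j) => //.
    by rewrite /homog -cm_comp hx.
  by rewrite -cm_diff dx linear0.
- move=> TN; apply: QN => y hy dy.
  have [|x [z [hx dx ->]]] := is_ N _ y hy dy.
    by lia.
  have [y' ->] := TN x hx dx; exists (i y' + z).
  by rewrite linearD cm_diff.
- by move=> l Nl lN; apply: Flow => //; lia.
- exact: FN.
exists (dgl_comp i w) => iw0; apply: nw.
apply: null_of_fib iw0 => v; apply: (@null_one_degree _ (N - 1 - d%:Z)); last first.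
  by apply: Flow; lia.
move=> j jN; apply: Hvanish_fib => // y hy dy.
have [aj|ja] := leP (N - 1 - d%:Z) (j - 1); first exact: is_.
have [|z ->] := Qlow (j - 1) _ y hy dy.
  by lia.
by exists 0, z; rewrite !linear0 add0r; split=> //; apply: homog0.
Qed.

(** Up to homotopy F is a retract of its truncation, from which a map to a
    module in degrees below m vanishes. *)
Lemma betti_zero_low (m : int) : (forall j : int, j < m -> Hvanish F j) ->
  forall l : int, l < m -> betti_zero l.
Proof.
move=> F0 l lm; apply: contrapT => nFl.
have [T [i [Tlow ii is_]]] := truncation R_conn F m.
have {}is_ j : Hsurj i j.
  have [jm y hy dy|] := ltP j m; last exact: is_.
  have [z ->] := F0 j jm y hy dy; exists 0, z.
  by rewrite !linear0 add0r; split=> //; apply: homog0.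
have [|u nu] := @nonnull_of_betti k R R_conn F k^o k^o (l - 1) 1 (oner_neq0 _).
  by rewrite subrK.
have [w idw] := lift_quasi_iso F_proj (dgl_id F) ii is_.
have ui0 x : u (i x) = 0.
  elim/homog_ind: x => [|x y IHx IHy|j x hx]; first by rewrite !linear0.
    by rewrite !linearD IHx IHy addr0.
  have [jm|jm] := ltP j m; first by rewrite (Tlow j x jm hx) !linear0.
  have : homog j (u (i x)) by rewrite /homog -!cm_comp hx.
  have lj : l < j by apply: lt_le_trans jm.
  rewrite /homog /= /triv_comp_fun subrK (gt_eqF lj).
  by rewrite gt_eqF // ltrBlDr (lt_trans lj) // ltzD1.
apply: nu; apply: null_homotopic_eq (homotopic_compl u idw) => x.
by rewrite dgl_subE /= ui0 subr0.
Qed.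

End Devissage.

(** Two K-projective resolutions are homotopy equivalent. *)
Lemma nonnull_transfer (k : fieldType) (R : dga k) (M Q : dglmod R)
    (F G : Kproj_resolution M) (w : dgl_map F Q) :
  ~ null_homotopic w -> exists w' : dgl_map G Q, ~ null_homotopic w'.
Proof.
move=> nw.
have iF := quasi_iso_Hinj (res_qis F); have sF := quasi_iso_Hsurj (res_qis F).
have iG := quasi_iso_Hinj (res_qis G); have sG := quasi_iso_Hsurj (res_qis G).
have [a ha] := lift_quasi_iso (@res_Kproj _ _ _ G) (res_map G) iF sF.
have [b hb] := lift_quasi_iso (@res_Kproj _ _ _ F) (res_map F) iG sG.
have ab : homotopic (dgl_id F) (dgl_comp a b).
  apply: (null_cancel (@res_Kproj _ _ _ F) iF sF).
  apply: null_homotopic_eq (homotopic_trans hb (homotopic_compr b ha)) => x.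
  by rewrite dgl_subE /= dgl_subE linearB.
exists (dgl_comp w a) => wa; apply: nw.
have wab : null_homotopic (dgl_comp w (dgl_comp a b)).
  by apply: null_homotopic_eq (null_compr b wa).
apply: null_homotopic_eq (homotopic_null (homotopic_sym (homotopic_compl w ab)) wab).
by [].
Qed.

(** The lowest class of P meets a class of the N-th Betti number. The dual of P,
    shifted to end in degree N, receives a map from F which is not null homotopic,
    and such a map detects the cohomology of the tensor product. *)
Lemma tensor_nonvanish (k : fieldType) (R : dga k) (R_conn : connected R)
    (R_deg1 : forall r : dga_cx R, homog 1 r -> r = 0)
    (M : dglmod R) (F G : Kproj_resolution M) (P : dgrmod R) (i s N : int) (d : nat) :
  (forall j : int, j < i -> Hvanish P j) -> (forall j : int, s < j -> Hvanish P j) ->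
  ~ Hvanish P i -> s - i <= d%:Z ->
  (forall l : int, N - d%:Z <= l -> l < N -> betti_zero R_conn F l) ->
  ~ betti_zero R_conn F N ->
  ~ Hvanish (Ltensor P G) (i + N).
Proof.
move=> Plow Phigh Pi sid Flow FN H0.
have [|||||w nw] := @nonnull_exists _ _ R_conn R_deg1 F (@res_Kproj _ _ _ F) N d (dual P (i + N)).
- move=> j jN; apply: dual_Hvanish; apply: Phigh.
  by lia.
- by move=> j Nj; apply: dual_Hvanish; apply: Plow; lia.
- by rewrite -{2}(addrK i N) [N + i]addrC; apply: dual_nonvanish.
- exact: Flow.
- exact: FN.
have [w' nw'] := nonnull_transfer G nw.
by apply: nw'; apply: dual_null.
Qed.

(** * Amplitudes *)

Lemma int_max (A : int -> Prop) (b j : int) : A j -> (forall i, A i -> i <= b) ->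
  exists2 m, A m & forall i, A i -> i <= m.
Proof.
move=> Aj Ab; have : `|b - j|%N = `|b - j|%N by [].
move: {1}`|b - j|%N => d; elim: d {-2}d (leqnn d) j Aj => [|d IH] e ed j Aj ej.
  by exists j => // i Ai; have := Ab _ Ai; have := Ab _ Aj; lia.
have [[i Ai ji]|nA] := pselect (exists2 i, A i & j < i).
  apply: (IH `|b - i|%N _ i Ai erefl); have := Ab _ Ai; lia.
exists j => // i Ai; rewrite leNgt; apply/negP => ji.
by apply: nA; exists i.
Qed.

Lemma int_min (A : int -> Prop) (b j : int) : A j -> (forall i, A i -> b <= i) ->
  exists2 m, A m & forall i, A i -> m <= i.
Proof.
move=> Aj Ab; have [||m Am mA] := @int_max (fun i => A (- i)) (- b) (- j).
- by rewrite opprK.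
- by move=> i /Ab; lia.
by exists (- m) => // i Ai; have := mA (- i); rewrite opprK => /(_ Ai); lia.
Qed.

Section ExtendedIntegers.
Implicit Types (A : set int).

Local Notation emb A := [set j%:E | j in A]%classic.

(** The function supremum returns its default value when there is no least upper
    bound; nonempty sets of integers do have one among the extended integers. *)
Lemma supremum_int A j : A j ->
  (exists m, [/\ A m, forall i, A i -> i <= m & supremum -oo%E (emb A) = m%:E])
  \/ (forall b, exists2 i, A i & b < i) /\ supremum -oo%E (emb A) = +oo%E.
Proof.
move=> Aj; have supE u : supremums (emb A) u -> supremum -oo%E (emb A) = u.
  move=> Au; rewrite /supremum; case: ifPn => [/eqP A0|_].
    by have : emb A j%:E by [exists j]; rewrite A0.
  by case: xgetP => [v -> Av|/(_ u) //]; apply: is_subset1_supremums Av Au.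
have [[b Ab]|nb] := pselect (exists b, forall i, A i -> i <= b).
  left; have [m Am mA] := int_max Aj Ab; exists m; split=> //; apply: supE; split.
    by move=> _ [i Ai <-]; rewrite lee_fin mA.
  by move=> u uA; apply: uA; exists m.
right; split.
  move=> b; apply: contrapT => nA; apply: nb; exists b => i Ai; rewrite leNgt.
  by apply/negP => bi; apply: nA; exists i.
apply: supE; split=> [_ [i _ <-]|u uA]; first exact: leey.
case: u uA => [b|//|] uA; last by have := uA j%:E (ex_intro2 _ _ j Aj erefl).
case: nb; exists b => i Ai; rewrite -lee_fin; apply: uA.
by exists i.
Qed.

Lemma infimum_int A j : A j ->
  (exists m, [/\ A m, forall i, A i -> m <= i & infimum +oo%E (emb A) = m%:E])
  \/ infimum +oo%E (emb A) = -oo%E.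
Proof.
move=> Aj; have infE u : infimums (emb A) u -> infimum +oo%E (emb A) = u.
  move=> Au; rewrite /infimum; case: ifPn => [/eqP A0|_].
    by have : emb A j%:E by [exists j]; rewrite A0.
  by case: xgetP => [v -> Av|/(_ u) //]; apply: is_subset1_infimums Av Au.
have [[b Ab]|nb] := pselect (exists b, forall i, A i -> b <= i).
  left; have [m Am mA] := int_min Aj Ab; exists m; split=> //; apply: infE; split.
    by move=> _ [i Ai <-]; rewrite lee_fin mA.
  by move=> u uA; apply: uA; exists m.
right; apply: infE; split=> [_ [i _ <-]|u uA]; first exact: leNye.
case: u uA => [b||//] uA; last by have := uA j%:E (ex_intro2 _ _ j Aj erefl).
case: nb; exists b => i Ai; rewrite -lee_fin; apply: uA.
by exists i.
Qed.

Lemma dimk_trivial (k : fieldType) (V : lmodType k) : dimk V = 0%E <-> trivial_space V.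
Proof.
pose A : set int := [set j | exists2 n : nat, (exists v : 'I_n -> V, lin_indep v) & n%:Z = j]%classic.
have dimE : dimk V = supremum -oo%E (emb A).
  rewrite /dimk; congr (supremum _ _); rewrite predeqE => x; split.
    by move=> [n nV <-]; exists n%:Z => //; exists n.
  by move=> [_ [n nV <-] <-]; exists n.
have A0 : A 0 by exists 0%N => //; exists (fun=> 0) => c _ [].
rewrite dimE; split=> [d0 v|V0].
  apply: contrapT => /eqP v0.
  have A1 : A 1.
    exists 1%N => //; exists (fun=> v) => c; rewrite big_ord1 => /eqP.
    by rewrite scaler_eq0 (negPf v0) orbF => /eqP c0 i; rewrite ord1.
  case: (supremum_int A0) => [[m [_ mA]]|[_]]; rewrite d0 // => -[m0].
  by have := mA _ A1; rewrite -m0.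
have A_le j : A j -> j <= 0.
  move=> [[|n] [v vi] <-] //; have := vi (fun=> 1).
  rewrite big1 => [/(_ erefl ord0)/eqP|i _]; last exact: V0.
  by rewrite oner_eq0.
case: (supremum_int A0) => [[m [Am mA ->]]|[/(_ 0)[i /A_le]]]; last by lia.
by congr (_%:E); apply/eqP; rewrite eq_le mA ?A_le.
Qed.

Section Amplitude.
Variables (k : fieldType) (X : complex k).

Lemma amp_ge (a b : int) : ~ Hvanish X a -> ~ Hvanish X b ->
  ((b - a)%:E <= amp X)%E.
Proof.
move=> Xa Xb; have Sa : hsupport X a by move/Hvanish_trivial.
have Sb : hsupport X b by move/Hvanish_trivial.
rewrite EFinB /amp; apply: leeB.
  by rewrite /hsup; case: (supremum_int Sb) => [[m [_ mS ->]]|[_ ->]]; rewrite ?lee_fin ?leey ?mS.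
by rewrite /hinf; case: (infimum_int Sa) => [[m [_ mS ->]]|->]; rewrite ?lee_fin ?leNye ?mS.
Qed.

Lemma amp_finite : nonzero_in_D X -> (amp X < +oo)%E ->
  exists i s : int, [/\ ~ Hvanish X i, forall j, j < i -> Hvanish X j,
    forall j, s < j -> Hvanish X j, i <= s & amp X = (s - i)%:E].
Proof.
move=> Xnz; have [j Sj] : exists j, hsupport X j.
  apply: contrapT => nS; apply: Xnz => j.
  by apply: contrapT => Xj; apply: nS; exists j.
rewrite /amp /hsup /hinf.
case: (supremum_int Sj) => [[s [_ sS ->]]|[_ ->]]; last first.
  by case: (infimum_int Sj) => [[m [_ _ ->]]|->].
case: (infimum_int Sj) => [[i [Si iS ->]]|-> //] _.
exists i, s; split=> //.
- by move/Hvanish_trivial.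
- move=> l li; apply/Hvanish_trivial; apply: contrapT => /iS; lia.
- move=> l sl; apply/Hvanish_trivial; apply: contrapT => /sS; lia.
- exact: le_trans (iS _ Sj) (sS _ Sj).
Qed.

End Amplitude.

End ExtendedIntegers.

Theorem theorem4p8 (k : fieldType) (R : dga k)
  (R_conn : connected R)
  (R_deg1 : forall r : dga_cx R, homog 1 r -> r = 0)
  (R_lf : locally_finite (dga_cx R))
  (M : dglmod R) (M_lf : locally_finite M) (M_bdd : bounded_below M)
  (P : dgrmod R) (P_lf : locally_finite P) (P_nz : nonzero_in_D P)
  (P_amp : (amp P < +oo)%E)
  (F G : Kproj_resolution M)
  (g : int) (g_ge : (amp P <= g%:E)%E)
  (gap : exists j : int,
    [/\ betti R_conn F j <> 0%E,
        forall l : int, j + 1 <= l <= j + g -> betti R_conn F l = 0%E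
      & betti R_conn F (j + g + 1) <> 0%E]) :
  ((g + 1)%:E <= amp (Ltensor P G))%E.
Proof.
have bettiE l : betti R_conn F l = 0%E <-> betti_zero R_conn F l.
  by rewrite /betti dimk_trivial Hvanish_trivial.
have [j [bj bgap bjg]] := gap.
have [i [s [Pi Plow Phigh is_ ampE]]] := amp_finite P_nz P_amp.
have gE : s - i <= g by rewrite -lee_fin -ampE.
have [m Mlow] := M_bdd.
have Fmin (l : int) : l < m -> betti_zero R_conn F l.
  apply: (betti_zero_low (@res_Kproj _ _ _ F)) => a am x hx dx.
  apply: (quasi_iso_Hinj (res_qis F) hx dx).
  have /Hvanish_trivial M0 := Mlow a am; apply: M0.
    by rewrite /homog -cm_comp hx.
  by rewrite -cm_diff dx linear0.
have nonzero l : betti R_conn F l <> 0%E -> ~ betti_zero R_conn F l.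
  by move=> bl Fl; apply: bl; apply: (bettiE l).2.
have [|m0 bm0 m0_min] := @int_min (fun l => ~ betti_zero R_conn F l) m j (nonzero j bj).
  by move=> l bl; rewrite leNgt; apply/negP => /Fmin.
have nonvanish (N : int) : (forall l : int, N - g <= l -> l < N -> betti_zero R_conn F l) ->
    ~ betti_zero R_conn F N -> ~ Hvanish (Ltensor P G) (i + N).
  move=> Nlow; apply: (@tensor_nonvanish _ _ R_conn R_deg1 M F G P i s N `|g|%N) => //.
    by lia.
  by move=> l Nl lN; apply: Nlow => //; lia.
(* The two classes come from the lowest nonzero Betti number and from the one at
   the upper end of the gap: the g Betti numbers before either of them vanish. *)
apply: le_trans (amp_ge (a := i + m0) (b := i + (j + g + 1)) _ _).
- have := m0_min _ (nonzero j bj); rewrite lee_fin; lia.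
- apply: nonvanish bm0 => l _ lm0; apply: contrapT => /m0_min.
  by lia.
- apply: nonvanish (nonzero _ bjg) => l jl ljg.
  by apply: (bettiE l).1; apply: bgap; lia.
Qed.
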